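(* Let $R_n$ be the rook monoid. Let $\mathcal{C}^{s}(R_n)$ (respectively $\mathcal{C}^{\lfloor s\rfloor}(R_n)$) denote the minimum, over all complete sets $\mathcal{Y}$ of inequivalent irreducible matrix representations of $\mathbb{C}R_n$, of the minimal number of operations needed to compute the Fourier transform (with respect to $\mathcal Y$) of an arbitrary element of $\mathbb{C}R_n$ given by its coefficients in the basis $\{s\}_{s\in R_n}$ (respectively in the groupoid basis $\{\lfloor s\rfloor\}_{s\in R_n}$), and let $\mathcal{C}(R_n)=\min(\mathcal{C}^{s}(R_n),\mathcal{C}^{\lfloor s\rfloor}(R_n))$. Then for any $\epsilon>0$, as $n\to\infty$, $$\mathcal{C}^{s}(R_n)=O\big(|R_n|^{1+\epsilon}\big),$$ and hence $$\mathcal{C}(R_n)=O\big(|R_n|^{1+\epsilon}\big).$$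
   Context: The rook monoid $R_n$ is the monoid of all partial injective maps of $\{1,\dots,n\}$ (bijections between subsets of $\{1,\dots,n\}$), under composition of partial functions; maps act on the left. The rank of $s\in R_n$ is $\mathrm{rk}(s)=|\mathrm{dom}(s)|$. Write $t\le s$ if $t$ is a restriction of $s$. The semigroup algebra $\mathbb{C}R_n$ has basis $\{s\}_{s\in R_n}$ with multiplication extended linearly from $R_n$; it is semisimple. Its groupoid basis is $\{\lfloor s\rfloor\}_{s\in R_n}$, where $\lfloor s\rfloor=\sum_{t\le s}(-1)^{\mathrm{rk}(t)-\mathrm{rk}(s)}\,t$ (equivalently $s=\sum_{t\le s}\lfloor t\rfloor$). A matrix representation of $\mathbb{C}R_n$ is an algebra homomorphism $\rho:\mathbb{C}R_n\to M_{d_\rho}(\mathbb{C})$. It is irreducible if the associated module is non-null and simple. Two representations are equivalent if they are conjugate by an invertible matrix. A complete set of inequivalent irreducible matrix representations contains exactly one representative of each equivalence class of irreducible representations. For such a set $\mathcal{Y}$: for $f=\sum_{s}f(s)s$ with arbitrary complex coefficients, $\mathcal{T}^{s}_{\mathcal{Y}}(R_n)$ is the minimal number of operations to compute $\hat f(\rho)=\sum_{s\in R_n}f(s)\rho(s)$ for all $\rho\in\mathcal{Y}$ from the input $(f(s))_{s\in R_n}$. For $f=\sum_s f(s)\lfloor s\rfloor$ with arbitrary complex coefficients, $\mathcal{T}^{\lfloor s\rfloor}_{\mathcal{Y}}(R_n)$ is the minimal number of operations to compute $\hat f(\rho)=\sum_{s\in R_n}f(s)\rho(\lfloor s\rfloor)$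 for all $\rho\in\mathcal{Y}$ from $(f(s))_{s\in R_n}$. Then $\mathcal{C}^{s}(R_n)=\min_{\mathcal{Y}}\mathcal{T}^{s}_{\mathcal{Y}}(R_n)$ and $\mathcal{C}^{\lfloor s\rfloor}(R_n)=\min_{\mathcal{Y}}\mathcal{T}^{\lfloor s\rfloor}_{\mathcal{Y}}(R_n)$. An operation is a single complex multiplication followed by a complex addition; the representations in $\mathcal Y$ are assumed precomputed and stored in memory. Concretely, one counts the steps of a straight-line program, each step forming $a\cdot b+c$ where each of $a,b,c$ is an input $f(s)$, a complex constant, or the result of an earlier step; copying or arranging already computed numbers is free. *)

(* Defs.v *)
From HB Require Import structures.
From mathcomp Require Import all_boot all_order all_algebra.
From mathcomp Require Import all_classical all_reals all_analysis.
From mathcomp Require Export complex.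

Set Implicit Arguments.
Unset Strict Implicit.
Unset Printing Implicit Defensive.

Import Order.TTheory GRing.Theory Num.Theory.
Local Open Scope ring_scope.

(* A partial map of {0, ..., n-1} is a finite function to [option 'I_n];
   [None] means undefined. *)
Definition partial_injective n (f : {ffun 'I_n -> option 'I_n}) : bool :=
  [forall i, forall j, (f i != None) && (f i == f j) ==> (i == j)].

Definition rook (n : nat) : Type :=
  {f : {ffun 'I_n -> option 'I_n} | partial_injective f}.

HB.instance Definition _ n := [isSub of rook n for @sval _ _].
HB.instance Definition _ n := Finite.on (rook n).

Section RookMonoid.
Variable n : nat.
Implicit Types s t u : rook n.

Lemma rook_inj s i j : val s i != None -> val s i = val s j -> i = j.
Proof.
move=> si sij; have /forallP/(_ i)/forallP/(_ j)/implyP := valP s.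
by move=> sP; apply/eqP/sP; rewrite si sij eqxx.
Qed.

Definition rook_one_fun : {ffun 'I_n -> option 'I_n} := [ffun i => Some i].

Lemma rook_one_subproof : partial_injective rook_one_fun.
Proof.
apply/forallP => i; apply/forallP => j; apply/implyP.
by rewrite !ffunE => /andP[_ /eqP[->]].
Qed.

Definition rook_one : rook n := Sub rook_one_fun rook_one_subproof.

(* Maps act on the left: (s t)(i) = s (t i). *)
Definition rook_mul_fun s t : {ffun 'I_n -> option 'I_n} :=
  [ffun i => obind (val s) (val t i)].

Lemma rook_mul_subproof s t : partial_injective (rook_mul_fun s t).
Proof.
apply/forallP => i; apply/forallP => j; apply/implyP.
rewrite !ffunE => /andP[] /[swap] /eqP.
case ti: (val t i) => [a|] //; case tj: (val t j) => [b|] //= sab sa.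
  apply/eqP/(@rook_inj t); first by rewrite ti.
  by rewrite ti tj (rook_inj sa sab).
by rewrite sab in sa.
Qed.

Definition rook_mul s t : rook n :=
  Sub (rook_mul_fun s t) (rook_mul_subproof s t).

Lemma rook_mulA : associative rook_mul.
Proof.
move=> s t u; apply/val_inj/ffunP => i; rewrite !SubK !ffunE !SubK.
by case: (val u i) => //= a; rewrite ffunE.
Qed.

Lemma rook_mul1 : left_id rook_one rook_mul.
Proof.
move=> s; apply/val_inj/ffunP => i; rewrite !SubK !ffunE !SubK.
by case: (val s i) => //= a; rewrite ffunE.
Qed.

Lemma rook_mulr1 : right_id rook_one rook_mul.
Proof. by move=> s; apply/val_inj/ffunP => i; rewrite SubK ffunE SubK ffunE. Qed.

HB.instance Definition _ :=
  isMonoid.Build (rook n) rook_mulA rook_mul1 rook_mulr1.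

Definition rook_dom s : {set 'I_n} := [set i | val s i != None].

Definition rook_rank s : nat := #|rook_dom s|.

Definition rook_restr t s : bool :=
  [forall i in rook_dom t, val t i == val s i].

End RookMonoid.

(* The element [a] stands for the sum of the [a s *: s]; the alias of the type
   of finite functions carries the convolution product instead of the
   pointwise one. *)
Definition rook_algebra (R : realType) (n : nat) : Type :=
  {ffun rook n -> R[i]}.

Section RookAlgebra.
Variables (R : realType) (n : nat).
Local Notation C := (R[i]).
Local Notation A := (rook_algebra R n).
Implicit Types (a b c : A) (s t u : rook n).

HB.instance Definition _ := GRing.Lmodule.copy A {ffun rook n -> C}.

Definition rook_basis (s : rook n) : A := [ffun t => (t == s)%:R].

Definition rook_conv a b : A :=
  \sum_s \sum_t (a s * b t) *: rook_basis (s * t)%g.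

Lemma rook_sumE (I : finType) (F : I -> A) u : (\sum_i F i) u = \sum_i F i u.
Proof. exact: (@sum_ffunE (rook n) C I _ _ F u). Qed.

Lemma rook_scaleE (k : C) a u : (k *: a) u = k * a u.
Proof. by rewrite ffunE. Qed.

Lemma rook_basis_delta (V : lmodType C) (G : rook n -> V) s :
  \sum_u rook_basis s u *: G u = G s.
Proof.
rewrite (bigD1 s)//= ffunE eqxx scale1r big1 ?addr0// => u /negPf us.
by rewrite ffunE us scale0r.
Qed.

Lemma rook_algebraE a : a = \sum_s a s *: rook_basis s.
Proof.
apply/ffunP => u; rewrite rook_sumE (bigD1 u)//= rook_scaleE ffunE eqxx mulr1.
rewrite big1 ?addr0// => s su.
by rewrite rook_scaleE ffunE eq_sym (negPf su) mulr0.
Qed.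

Lemma rook_conv_sum (V : lmodType C) (G : rook n -> V) a b :
  \sum_u rook_conv a b u *: G u = \sum_s \sum_t (a s * b t) *: G (s * t)%g.
Proof.
under eq_bigr do rewrite rook_sumE scaler_suml.
rewrite exchange_big/=; apply: eq_bigr => s _.
under eq_bigr do rewrite rook_sumE scaler_suml.
rewrite exchange_big/=; apply: eq_bigr => t _.
under eq_bigr do rewrite rook_scaleE -scalerA.
by rewrite -scaler_sumr rook_basis_delta.
Qed.

Lemma rook_convE a b :
  rook_conv a b = \sum_s a s *: \sum_t b t *: rook_basis (s * t)%g.
Proof.
apply: eq_bigr => s _; rewrite scaler_sumr.
by apply: eq_bigr => t _; rewrite scalerA.
Qed.

Lemma rook_convA : associative rook_conv.
Proof.
move=> a b c; rewrite [RHS]rook_convE rook_conv_sum rook_convE.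
apply: eq_bigr => s _; rewrite rook_conv_sum scaler_sumr.
apply: eq_bigr => t _; rewrite -scalerA; congr (_ *: _).
rewrite scaler_sumr; apply: eq_bigr => u _.
by rewrite scalerA mulgA.
Qed.

Lemma rook_conv1 : left_id (rook_basis 1%g) rook_conv.
Proof.
move=> a; rewrite rook_convE rook_basis_delta [RHS]rook_algebraE.
by apply: eq_bigr => s _; rewrite mul1g.
Qed.

Lemma rook_convr1 : right_id (rook_basis 1%g) rook_conv.
Proof.
move=> a; rewrite rook_convE [RHS]rook_algebraE; apply: eq_bigr => s _.
by rewrite rook_basis_delta mulg1.
Qed.

Lemma rook_convDl : left_distributive rook_conv +%R.
Proof.
move=> a b c; rewrite /rook_conv -big_split; apply: eq_bigr => s _ /=.
by rewrite -big_split; apply: eq_bigr => t _; rewrite ffunE mulrDl scalerDl.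
Qed.

Lemma rook_convDr : right_distributive rook_conv +%R.
Proof.
move=> a b c; rewrite /rook_conv -big_split; apply: eq_bigr => s _ /=.
by rewrite -big_split; apply: eq_bigr => t _; rewrite ffunE mulrDr scalerDl.
Qed.

Lemma rook_conv1_neq0 : rook_basis 1%g != 0.
Proof.
apply/eqP => /ffunP/(_ 1%g); rewrite !ffunE eqxx => /eqP.
by rewrite oner_eq0.
Qed.

HB.instance Definition _ := GRing.Zmodule_isNzRing.Build A
  rook_convA rook_conv1 rook_convr1 rook_convDl rook_convDr rook_conv1_neq0.

Lemma rook_scalerAl (k : C) a b : k *: (a * b) = (k *: a) * b.
Proof.
rewrite [LHS]scaler_sumr; apply: eq_bigr => s _.
rewrite scaler_sumr; apply: eq_bigr => t _.
by rewrite scalerA rook_scaleE mulrA.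
Qed.

HB.instance Definition _ := GRing.Lmodule_isLalgebra.Build C A rook_scalerAl.

Lemma rook_scalerAr (k : C) a b : k *: (a * b) = a * (k *: b).
Proof.
rewrite [LHS]scaler_sumr; apply: eq_bigr => s _.
rewrite scaler_sumr; apply: eq_bigr => t _.
by rewrite scalerA rook_scaleE mulrCA.
Qed.

HB.instance Definition _ := GRing.Lalgebra_isAlgebra.Build C A rook_scalerAr.

Definition groupoid_basis s : A :=
  \sum_(t | rook_restr t s)
    ((-1 : C) ^ ((rook_rank t)%:Z - (rook_rank s)%:Z)) *: rook_basis t.

End RookAlgebra.

Section Representations.
Variables (R : realType) (n : nat).
Local Notation C := (R[i]).
Local Notation A := (rook_algebra R n).

Definition matrix_rep (d : nat) : Type := {lrmorphism A -> 'M[C]_d}.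

(* The module of [rho] is the space of column vectors of size [d], on which
   [a] acts by [v |-> rho a *m v]. *)
Definition submodule d (rho : matrix_rep d) (U : {vspace 'cV[C]_d}) : Prop :=
  forall a v, v \in U -> rho a *m v \in U.

Definition irreducible_rep d (rho : matrix_rep d) : Prop :=
  (exists a, rho a != 0) /\
  (forall U, submodule rho U -> U = 0%VS \/ U = fullv).

Definition equivalent_rep d (rho rho' : matrix_rep d) : Prop :=
  exists2 P : 'M[C]_d, P \in unitmx &
    forall a, rho' a = P *m rho a *m invmx P.

(* A set of matrix representations is given by its members of each degree;
   representations of different degrees are never equivalent. *)
Definition rep_set : Type := forall d, set (matrix_rep d).

Definition complete_irreps (Y : rep_set) : Prop :=
  (forall d (rho : matrix_rep d), Y d rho -> irreducible_rep rho) /\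
  (forall d (rho : matrix_rep d), irreducible_rep rho ->
     exists! rho' : matrix_rep d, Y d rho' /\ equivalent_rep rho rho').

(* With [e] one of the two bases, the transform of [\sum_s f s *: e s]. *)
Definition fourier (e : rook n -> A) d (rho : matrix_rep d)
    (f : rook n -> C) : 'M[C]_d :=
  \sum_s f s *: rho (e s).

End Representations.

Section StraightLine.
Variables (K : pzSemiRingType) (I : Type).

Variant operand := Input of I | Const of K | Step of nat.

(* The step [(a, b, c)] forms [a * b + c]. *)
Definition step : Type := operand * operand * operand.

Definition program : Type := seq step.

(* [w] lists the results of the steps already executed. A [Step] that refers
   to no earlier step reads as the constant 0. *)
Definition operand_value (f : I -> K) (w : seq K) (o : operand) : K :=
  match o with
  | Input i => f i
  | Const k => k
  | Step j => nth 0 w j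
  end.

Definition exec_step (f : I -> K) (w : seq K) (x : step) : seq K :=
  let: (a, b, c) := x in
  rcons w (operand_value f w a * operand_value f w b + operand_value f w c).

Definition run (p : program) (f : I -> K) : seq K :=
  foldl (exec_step f) [::] p.

Definition computes (p : program) (g : (I -> K) -> K) : Prop :=
  exists o : operand, forall f, g f = operand_value f (run p f) o.

End StraightLine.

Local Open Scope classical_set_scope.

Section Complexity.
Variables (R : realType) (n : nat).
Local Notation C := (R[i]).
Local Notation A := (rook_algebra R n).

Definition computes_fourier (e : rook n -> A) (Y : rep_set R n)
    (p : program C (rook n)) : Prop :=
  forall d (rho : matrix_rep R n d), Y d rho ->
    forall i j, computes p (fun f => fourier e rho f i j).

(* These are infima of sets of natural numbers, so they are minima unless the
   set is empty, in which case the value is [+oo]. *)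
Definition transform_cost (e : rook n -> A) (Y : rep_set R n) : \bar R :=
  ereal_inf [set (size p)%:R%:E | p in computes_fourier e Y].

Definition min_cost (e : rook n -> A) : \bar R :=
  ereal_inf [set transform_cost e Y | Y in @complete_irreps R n].

Definition cost_s : \bar R := min_cost (@rook_basis R n).

Definition cost_groupoid : \bar R := min_cost (@groupoid_basis R n).

Definition cost : \bar R := Order.min cost_s cost_groupoid.

End Complexity.

(* [u n = O(g n)] as [n] goes to infinity, for an extended real sequence [u];
   in particular [u n] is eventually finite. *)
Definition ereal_bigO (R : realType) (u : nat -> \bar R) (g : nat -> R) : Prop :=
  exists K : R, \forall n \near \oo, (`|u n| <= (K * `|g n|)%:E)%E.

(* Main.v *)
Require Import Defs.
From HB Require Import structures.
From mathcomp Require Import all_boot all_order all_algebra.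
From mathcomp Require Import all_classical all_reals all_analysis.
From mathcomp Require Import zify pgroup mxrepresentation character.
From mathcomp Require Import fintype finset all_fingroup.

(* The algebra of the rook monoid is a direct sum, over k, of matrix algebras of
   size 'C(n, k) over the algebra of S_k. Hence a family of irreducible
   representations of the groups S_k yields one of the monoid, and the transform
   of [f] amounts to computing, for every partial injection t, the sum of [f]
   over the extensions of t, followed by 'C(n, k) ^ 2 Fourier transforms on each
   S_k. The first part takes at most 2 ^ n * |R_n| operations.

   For the second part choose the irreducible representations of S_(k+1) block
   diagonal on S_k, with the chosen representations of S_k as blocks. The
   transform on S_(k+1) reduces to k + 1 transforms on S_k, followed by products
   with the matrices of adjacent transpositions. Such a transposition lies in
   S_(j+2) and centralises S_j, so by Schur's lemma each row of its matrix has at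
   most as many nonzero entries as an irreducible representation of S_j has
   occurrences in one of S_(j+2), which is at most the index of S_j in S_(j+2).
   Hence the transform on S_k costs at most (k + 1) ^ 5 * k! operations.

   Altogether the cost is at most (2 ^ n + (n + 1) ^ 5) * |R_n|, and the first
   factor is O(|R_n| ^ eps) since |R_n| >= n!. *)

Set Implicit Arguments.
Unset Strict Implicit.
Unset Printing Implicit Defensive.

Import Order.TTheory GRing.Theory Num.Theory.
Local Open Scope ring_scope.

(** * Linear independence of coefficient functions *)

Section Coefficients.
Variables (F : fieldType) (I X : finType) (A : {set I}) (B : {set X}).
Variable M : I -> X -> F.

(** Linear independence on [B] of the functions [M i] for [i] in [A], phrased as solvability of the
    corresponding system. *)
Definition coef_onto : Prop := forall T : I -> F,
  exists a : X -> F, {in A, forall i, \sum_(x in B) a x * M i x = T i}.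

Definition coef_separating : Prop := forall a : X -> F,
  {in A, forall i, \sum_(x in B) a x * M i x = 0} -> {in B, forall x, a x = 0}.

Let Mx : 'M[F]_(#|B|, #|A|) := \matrix_(x, i) M (enum_val i) (enum_val x).

Let extend (v : 'rV[F]_#|B|) (x : X) : F :=
  \sum_j v 0 j *+ (enum_val j == x).

Let extendE v j : extend v (enum_val j) = v 0 j.
Proof.
rewrite /extend (bigD1 j) //= eqxx mulr1n big1 ?addr0 // => k kj.
by rewrite (inj_eq enum_val_inj) (negPf kj).
Qed.

Let extend_mul v i : \sum_(x in B) extend v x * M (enum_val i) x = (v *m Mx) 0 i.
Proof. by rewrite big_enum_val mxE; apply: eq_bigr => j _; rewrite extendE mxE. Qed.

Let restrict (a : X -> F) : 'rV[F]_#|B| := \row_j a (enum_val j).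

Let restrict_mul a i :
  \sum_(x in B) a x * M (enum_val i) x = (restrict a *m Mx) 0 i.
Proof. by rewrite big_enum_val mxE; apply: eq_bigr => j _; rewrite !mxE. Qed.

Let coef_onto_full : coef_onto <-> row_full Mx.
Proof.
split=> [solve | full T].
  rewrite -sub1mx; apply/row_subP => i; apply/submxP.
  have [a aT] := solve (fun j => (j == enum_val i)%:R).
  exists (restrict a); apply/rowP => j; rewrite -restrict_mul aT ?enum_valP //.
  by rewrite !mxE (inj_eq enum_val_inj) eq_sym.
have [v vT] := submxP (submx_full (\row_i T (enum_val i)) full).
exists (extend v) => i Ai; rewrite -(enum_rankK_in Ai Ai) extend_mul -vT.
by rewrite mxE.
Qed.

Let coef_separating_free : coef_separating <-> row_free Mx.
Proof.
split=> [sep | free a aM x Bx].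
  rewrite -kermx_eq0; apply/rowV0P => v /sub_kermxP vM; apply/rowP => j.
  rewrite mxE -extendE; apply: sep (enum_valP j) => i Ai.
  by rewrite -(enum_rankK_in Ai Ai) extend_mul vM mxE.
have aM0 : restrict a *m Mx = 0.
  by apply/rowP => i; rewrite -restrict_mul aM ?enum_valP // mxE.
have /rowP r0 : restrict a = 0.
  by apply: (row_free_inj free); rewrite /= mul0mx.
by have := r0 (enum_rank_in Bx x); rewrite !mxE enum_rankK_in.
Qed.

(** The rank of a product of matrices is at most its inner dimension. This later bounds
    multiplicities. *)
Lemma coef_onto_leq (K : finType) (D : {set K}) (P : I -> K -> F)
    (Q : K -> X -> F) :
  {in A & B, forall i x, M i x = \sum_(k in D) P i k * Q k x} ->
  coef_onto -> (#|A| <= #|D|)%N.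
Proof.
move=> MPQ /coef_onto_full/eqP <-.
pose Px := \matrix_(k < #|D|, i < #|A|) P (enum_val i) (enum_val k).
pose Qx := \matrix_(x < #|B|, k < #|D|) Q (enum_val k) (enum_val x).
have -> : Mx = Qx *m Px.
  apply/matrixP => x i; rewrite !mxE MPQ ?enum_valP // big_enum_val.
  by apply: eq_bigr => k _; rewrite !mxE mulrC.
by rewrite (leq_trans (mxrankM_maxl _ _)) // rank_leq_col.
Qed.

Lemma coef_onto_separating : (#|B| <= #|A|)%N -> coef_onto -> coef_separating.
Proof.
move=> leBA /coef_onto_full/eqP rA; apply/coef_separating_free.
by rewrite /row_free eqn_leq rank_leq_row rA.
Qed.

Lemma coef_separating_onto : (#|A| <= #|B|)%N -> coef_separating -> coef_onto.
Proof.
move=> leAB /coef_separating_free/eqP rB; apply/coef_onto_full.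
by rewrite /row_full eqn_leq rank_leq_col rB.
Qed.

End Coefficients.

(** * Irreducible representations of a finite group *)

Lemma big_tagged (R : Type) (idx : R) (op : Monoid.com_law idx) (I : finType)
    (J : I -> finType) (f : {i : I & J i} -> R) :
  \big[op/idx]_z f z = \big[op/idx]_i \big[op/idx]_(a : J i) f (Tagged (fun k => J k) a).
Proof. by rewrite sig_big_dep; apply: eq_bigr => -[]. Qed.

Lemma num_pchar' (F : numClosedFieldType) (gT : finGroupType) (G : {group gT}) :
  [pchar F]^'.-group%g G.
Proof.
apply: sub_in_pnat (pgroup_pi G) => p _ _.
by rewrite inE /= [_ \in _]pchar_num.
Qed.

Section IrreducibleFamilies.
Variables (F : numClosedFieldType) (gT : finGroupType).
Implicit Types G H K : {group gT}.

Let splitF G : group_splitting_field F G.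
Proof. exact: group_closure_closed_field. Qed.

Definition irr_index G : irrType F G := DecSocleType (regular_repr F G).

(** One representation is fixed in each isomorphism class, with its basis left free; adapted bases
    exploit this freedom. *)
Record irr_family G := IrrFamily {
  irr_member :> irr_index G -> representation F G;
  irr_member_rsim : forall i, mx_rsim (irr_repr i) (irr_member i)
}.

Definition irr_basis G (W : irr_family G) : finType :=
  {i : irr_index G & 'I_(rdegree (W i))}.

(* The direct sum of the members of [W], as one block diagonal matrix. *)
Definition irr_coef G (W : irr_family G) (g : gT) (x y : irr_basis W) : F :=
  if tag x == tag y then W (tag x) g (tagged x) (tagged_as x y) else 0.

Section FamilyCoefficients.
Variables (G : {group gT}) (W : irr_family G).
Local Notation B := (irr_basis W).
Local Notation coef := (@irr_coef G W).
Implicit Types (x y z : B) (g h : gT).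

Definition irr_pairs : {set B * B} := [set p | tag p.1 == tag p.2].

Lemma irr_coef_off g x y : tag x != tag y -> coef g x y = 0.
Proof. by rewrite /irr_coef => /negPf ->. Qed.

Lemma irr_coef_on i g (a b : 'I_(rdegree (W i))) :
  coef g (Tagged _ a) (Tagged _ b) = W i g a b.
Proof. by rewrite /irr_coef /= eqxx tagged_asE. Qed.

Lemma irr_coefM : {in G &, forall g h x y,
  coef (g * h)%g x y = \sum_z coef g x z * coef h z y}.
Proof.
move=> g h Gg Gh [i a] y; rewrite big_tagged (bigD1 i) //= addrC big1 ?add0r.
  have [yi|yi] := eqVneq i (tag y); last first.
    rewrite irr_coef_off // big1 // => b _.
    by rewrite [coef h _ _]irr_coef_off ?mulr0.
  case: y yi => j b /= ij; case: j / ij b => b.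
  rewrite irr_coef_on repr_mxM // mxE.
  by apply: eq_bigr => c _; rewrite !irr_coef_on.
by move=> j ji; rewrite big1 // => b _; rewrite irr_coef_off ?mul0r //= eq_sym.
Qed.

Lemma sum_rdegree : (\sum_i rdegree (W i) ^ 2 = #|G|)%N.
Proof.
rewrite -(sum_irr_degree_pchar (irr_index G) (num_pchar' F G) (splitF (G := G))).
by apply: eq_bigr => i _; rewrite (mxrank_rsim (irr_member_rsim W i)).
Qed.

Lemma card_irr_pairs : #|irr_pairs| = #|G|.
Proof.
transitivity (\sum_(x : B) \sum_(y : B) (tag x == tag y : nat))%N.
  rewrite -sum1_card big_mkcond (pair_bigA _ (fun x y : B => _ : nat)) /=.
  by apply: eq_bigr => p _; rewrite inE; case: eqP.
rewrite -sum_rdegree big_tagged; apply: eq_bigr => i _; rewrite expnS expn1.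
rewrite -[X in (X * _)%N]card_ord -sum_nat_const; apply: eq_bigr => a _.
rewrite big_tagged (bigD1 i) //= [X in (_ + X)%N]big1 => [|j /negPf ji].
  by under eq_bigr do rewrite eqxx; rewrite sum1_card card_ord addn0.
by rewrite big1 // => b _; rewrite /= eq_sym ji.
Qed.

Let member_abs_irr i : mx_absolutely_irreducible (W i).
Proof.
by rewrite -(mx_rsim_abs_irr (irr_member_rsim W i)); apply/splitF/socle_irr.
Qed.

Let member_irr i : mx_irreducible (W i).
Proof. exact/mx_abs_irrW/member_abs_irr. Qed.

Let member_op_id i j : j != i -> gring_op (W i) (Wedderburn_id j) = 0.
Proof.
move=> ji; apply: (irr_comp'_op0_pchar (num_pchar' F G) _ _ (Wedderburn_id_mem j)) => //.
rewrite -(irr_comp_rsim_pchar _ (num_pchar' F G) (irr_member_rsim W i)).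
by rewrite (irr_reprK_pchar (num_pchar' F G)).
Qed.

Let member_op_id1 i : gring_op (W i) (Wedderburn_id i) = 1%:M.
Proof.
rewrite -(gring_op1 (W i)) -(Wedderburn_sum_id_pchar (irr_index G) (num_pchar' F G)).
rewrite linear_sum (bigD1 i) //= addrC big1 ?add0r // => j.
exact: member_op_id.
Qed.

Let Wedderburn_id_gring (i : irr_index G) :
  (Wedderburn_id i \in group_ring F G)%MS.
Proof.
rewrite -(Wedderburn_sum_pchar (irr_index G) (num_pchar' F G)).
by rewrite (sumsmx_sup i) ?Wedderburn_id_mem.
Qed.

(** Absolute irreducibility lifts a prescribed matrix in each member to the group ring, and the
    Wedderburn idempotents glue these lifts into one element. *)
Lemma irr_coef_onto :
  coef_onto irr_pairs G (fun p g => coef g p.1 p.2).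
Proof.
move=> T.
pose vec i (b : 'I_(rdegree (W i))) : B := Tagged (fun k => 'I_(rdegree (W k))) b.
pose M i : 'M[F]_(rdegree (W i)) := \matrix_(b, c) T (vec i b, vec i c).
have ex_A i : exists A, (A \in group_ring F G)%MS /\ gring_op (W i) A = M i.
  have [_ [a /(_ (M i)) Ma]] := mx_abs_irrP (member_abs_irr i).
  exists (\sum_(x in G) a x (M i) *: regular_repr F G x); split.
    by apply/envelop_mxP; exists (a^~ (M i)).
  rewrite linear_sum [RHS]Ma; apply: eq_bigr => x Gx.
  by rewrite linearZ /= gring_opG.
have [A_ A_P] := fin_all_exists ex_A.
pose A := \sum_i A_ i *m Wedderburn_id i.
have opA i : gring_op (W i) A = M i.
  rewrite /A linear_sum (bigD1 i) //= big1 ?addr0 => [|j ji].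
    by rewrite gring_opM // member_op_id1 mulmx1; case: (A_P i).
  by rewrite gring_opM // member_op_id // mulmx0.
have /envelop_mxP[a Aa] : (A \in group_ring F G)%MS.
  rewrite /A linear_sum summx_sub // => i _.
  by apply: envelop_mxM => //; case: (A_P i).
exists a => -[[i b] y] /[!inE] /= /eqP iy.
case: y iy => j c /= ij; case: j / ij c => c.
transitivity (M i b c); last by rewrite mxE.
rewrite -opA Aa linear_sum summxE; apply: eq_bigr => g Gg.
by rewrite linearZ /= gring_opG // mxE irr_coef_on.
Qed.

Lemma irr_coef_solve (T : B -> B -> F) : exists a : gT -> F,
  forall x y, tag x = tag y -> \sum_(g in G) a g * coef g x y = T x y.
Proof.
have [a aT] := irr_coef_onto (fun p => T p.1 p.2).
by exists a => x y xy; apply: (aT (x, y)); rewrite inE /= xy.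
Qed.

(** There are as many pairs as group elements, so the surjective transform is also injective. *)
Lemma irr_coef_separate (a : gT -> F) :
  (forall x y, tag x = tag y -> \sum_(g in G) a g * coef g x y = 0) ->
  {in G, forall g, a g = 0}.
Proof.
move=> a0; apply: (coef_onto_separating _ irr_coef_onto).
  by rewrite card_irr_pairs.
by move=> [x y] /[!inE] /eqP; apply: a0.
Qed.

End FamilyCoefficients.
End IrreducibleFamilies.

Arguments irr_basis : simpl never.
Arguments irr_pairs {F gT G} W.
Arguments irr_coef_onto {F gT G} W.
Arguments irr_coef_solve {F gT G} W.
Arguments irr_coef_separate {F gT G} W.
Arguments card_irr_pairs {F gT G} W.
Arguments sum_rdegree {F gT G} W.

(** * Adapted families *)

Section AdaptedFamilies.
Variables (F : numClosedFieldType) (gT : finGroupType).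
Implicit Types G H K : {group gT}.

(* The representation [r] is block diagonal with members of [V] as blocks: the
   basis vector [x] lies in the block numbered [blk x], where it plays the role
   of the basis vector [pos x] of a member of [V]. *)
Record blocks G (V : irr_family F G) (B : Type) (r : gT -> B -> B -> F)
    (blk : B -> nat) (pos : B -> irr_basis V) : Prop := Blocks {
  blocks_coef : {in G, forall g x y,
    r g x y = if blk x == blk y then irr_coef g (pos x) (pos y) else 0};
  blocks_tag : forall x y, blk x = blk y -> tag (pos x) = tag (pos y);
  blocks_inj : forall x y, blk x = blk y -> pos x = pos y -> x = y;
  blocks_full : forall x z, tag z = tag (pos x) ->
    exists2 y, blk y = blk x & pos y = z
}.

Record adapted G H (W : irr_family F G) (V : irr_family F H)
    (blk : irr_basis W -> nat) (pos : irr_basis W -> irr_basis V) : Prop :=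
  Adapted {
  adapted_blocks : blocks (@irr_coef _ _ _ W) blk pos;
  adapted_tag : forall x y, blk x = blk y -> tag x = tag y
}.

(** By induction on the sum: the new summand becomes block 0 and the earlier block numbers move up
    by one. *)
Lemma blocks_dsum H (V : irr_family F H) (L : finType) (j : L -> irr_index F H)
    (D := \big[dadd_grepr/grepr0]_l V (j l)) :
  exists blk pos, @blocks H V 'I_(rdegree D) (fun h => D h) blk pos.
Proof.
rewrite {}/D; elim/big_rec: _ => [|l D _ [blk [pos bD]]] /=.
  by exists (fun=> 0%N), (fun x : 'I_0 => False_rect _ (notF (ltn_ord x)));
     split=> [h Hh []|[]|[]|[]].
pose W := V (j l).
pose inW (a : 'I_(rdegree W)) : irr_basis V :=
  Tagged (fun k => 'I_(rdegree (V k))) a.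
exists (fun x : 'I_(rdegree W + rdegree D) =>
  if split x is inr a then (blk a).+1 else 0%N).
exists (fun x : 'I_(rdegree W + rdegree D) =>
  match split x with inl a => inW a | inr a => pos a end).
split.
- move=> h Hh x y; rewrite -(splitK x) -(splitK y) !unsplitK.
  case: (split x) (split y) => [a|a] [b|b] /=.
  + by rewrite block_mxEul irr_coef_on.
  + by rewrite block_mxEur mxE.
  + by rewrite block_mxEdl mxE.
  by rewrite block_mxEdr eqSS (blocks_coef bD).
- move=> x y; case: (split x) (split y) => [a|a] [b|b] //= -[].
  exact: blocks_tag bD _ _.
- move=> x y; rewrite -{3}(splitK x) -{3}(splitK y).
  case: (split x) (split y) => [a|a] [b|b] //=.
    by move=> _ /eqP; rewrite -tag_eqE /tag_eq /= eqxx tagged_asE => /eqP ->.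
  by case=> ab pab; rewrite (blocks_inj bD ab pab).
move=> x; case: (split x) => [a|a] z /= zx.
  case: z zx => k c /= /esym ck; case: k / ck c => c.
  by exists (lshift _ c); rewrite (unsplitK (inl c)).
have [y yb yz] := blocks_full bD zx.
by exists (rshift _ y); rewrite (unsplitK (inr y)) ?yb.
Qed.

Lemma rsim_dsum_members H (V : irr_family F H) n (rH : mx_representation F H n) :
  exists (L : finType) (j : L -> irr_index F H),
    mx_rsim rH (\big[dadd_grepr/grepr0]_l V (j l)).
Proof.
pose sH := DecSocleType rH.
have [L U /= simU defS dxU] := Socle_semisimple sH.
have soc1 : Socle sH = 1%:M by apply/reducible_Socle1/mx_Maschke_pchar/num_pchar'.
pose modU l := mxsimple_module (simU l).
exists L, (fun l => irr_comp (irr_index F H) (submod_repr (modU l))).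
apply: mx_rsim_trans (mx_rsim_sym (rsim_submod1 (mxmodule1 rH) _)) _ => //.
apply: (mx_rsim_dsum (modU := modU)) => //; first by rewrite -soc1.
move=> l; apply: mx_rsim_trans (irr_member_rsim V _).
by apply: (rsim_irr_comp_pchar _ (num_pchar' F H)); apply/submod_mx_irr/simU.
Qed.

(** The change of basis that turns the restriction to [H] into [D] is applied to all of [G]. *)
Lemma extend_rsim G H (sHG : H \subset G) n (rG : mx_representation F G n)
    (D : representation F H) : mx_rsim (subg_repr rG sHG) D ->
  exists2 E : mx_representation F G (rdegree D),
    mx_rsim rG E & {in H, forall h, E h = D h}.
Proof.
case: D => m rD /= [B nm Bfree BH]; case: m / nm rD B Bfree BH => rD B.
rewrite row_free_unit => uB BH.
have uB' : invmx B \in unitmx by rewrite unitmx_inv.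
exists (rconj_repr rG uB').
  exists B => //; first by rewrite row_free_unit.
  by move=> g _; rewrite /= /rconj_mx invmxK !mulmxA mulmxV // mul1mx.
by move=> h Hh; rewrite /= /rconj_mx invmxK -mulmxA BH // mulKmx.
Qed.

(** By Maschke's theorem the restriction of each irreducible representation to [H] splits, and a
    change of basis makes the blocks equal to members of [V], not merely isomorphic to them. *)
Lemma adapted_exists G H (sHG : H \subset G) (V : irr_family F H) :
  exists (W : irr_family F G) blk pos, @adapted G H W V blk pos.
Proof.
have ex_i (i : irr_index F G) : exists E : representation F G,
    mx_rsim (irr_repr i) E /\ exists blk pos,
      @blocks H V 'I_(rdegree E) (fun h => E h) blk pos.
  have [L [j simD]] := rsim_dsum_members V (subg_repr (irr_repr i) sHG).
  have [E simE EH] := extend_rsim simD.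
  exists (Representation E); split=> //=.
  have [blk [pos [bc bt bi bf]]] := blocks_dsum V j.
  by exists blk, pos; split=> // h Hh x y; rewrite EH ?bc.
have [W_ W_P] := fin_all_exists ex_i.
pose W := IrrFamily (fun i => (W_P i).1).
have [blk_ /fin_all_exists[pos_ bW]] := fin_all_exists (fun i => (W_P i).2).
(* [pickle] codes a member and a block inside it as one number, so blocks of different members stay
   distinct. *)
exists W, (fun x => pickle (tag x, blk_ _ (tagged x))).
exists (fun x => pos_ _ (tagged x)).
have pickle_inj := pcan_inj (@pickleK (irr_index F G * nat)%type).
split=> [|x y /pickle_inj[] //]; split.
- move=> h Hh [i a] [k b] /=; rewrite (inj_eq pickle_inj) xpair_eqE.
  have [ik|ik] /= := eqVneq i k; last by rewrite irr_coef_off.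
  case: k / ik b => b.
  by rewrite irr_coef_on (blocks_coef (bW i)).
- move=> [i a] [k b] /= /pickle_inj[ik]; case: k / ik b => b.
  exact: (blocks_tag (bW i)).
- move=> [i a] [k b] /= /pickle_inj[ik]; case: k / ik b => b.
  by move=> ab pab; rewrite (blocks_inj (bW i) ab pab).
move=> [i a] z /= /(blocks_full (bW i))[b ab <-].
by exists (Tagged (fun k => 'I_(rdegree (W k))) b); rewrite //= ab.
Qed.

Lemma adapted_refl G (W : irr_family F G) :
  adapted (fun x : irr_basis W => pickle (tag x)) id.
Proof.
have pickle_inj := pcan_inj (@pickleK (irr_index F G)).
split=> [|x y /pickle_inj //]; split=> [g Gg x y|x y /pickle_inj//|//|x z zx].
  rewrite (inj_eq pickle_inj).
  by have [//|xy] := eqVneq (tag x) (tag y); rewrite irr_coef_off.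
by exists z; [rewrite zx|].
Qed.

(** Blocks are refined: a block for [K] lies in a block for [H], and [adapted_tag] for [V] keeps it
    inside one member of [V], so that every position in it is reached. *)
Lemma adapted_trans G H K (W : irr_family F G) (V : irr_family F H)
    (U : irr_family F K) blkV posV blkU posU : K \subset H ->
  @adapted G H W V blkV posV -> @adapted H K V U blkU posU ->
  adapted (fun x => pickle (blkV x, blkU (posV x))) (posU \o posV).
Proof.
move=> sKH [[cV tV iV fV] tW] [[cU tU iU fU] tV'].
have pickle_inj := pcan_inj (@pickleK (nat * nat)%type).
split=> [|x y /pickle_inj[/tW //]]; split.
- move=> k Kk x y; rewrite (inj_eq pickle_inj) xpair_eqE cV ?(subsetP sKH) //.
  by case: eqP => //= _; rewrite cU.
- by move=> x y /pickle_inj[_]; apply: tU.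
- by move=> x y /pickle_inj[xy /iU pxy /pxy]; apply: iV.
move=> x z /= /fU[w wx wz]; have [y yx yw] := fV x w (tV' _ _ wx).
by exists y; rewrite /= ?yx ?yw ?wx.
Qed.

Lemma adapted_chain (Gam : nat -> {group gT}) :
  (forall k, Gam k \subset Gam k.+1) ->
  exists W : forall k, irr_family F (Gam k), forall k, exists blk pos,
    @adapted (Gam k.+1) (Gam k) (W k.+1) (W k) blk pos.
Proof.
move=> GamS.
pose W0 : irr_family F (Gam 0) := IrrFamily
  (irr_member := fun i => Representation (irr_repr i)) (fun i => mx_rsim_refl _).
pose next k V := sval (boolp.cid (adapted_exists (GamS k) V)).
exists (nat_rect (fun k => irr_family F (Gam k)) W0 next) => k /=.
exact: svalP (boolp.cid (adapted_exists (GamS k) _)).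
Qed.

End AdaptedFamilies.

(** * Sparsity *)

Lemma leq_card_in_set (T T' : finType) (A : {set T}) (B : {set T'}) (f : T -> T') :
  {in A &, injective f} ->
  {in A, forall x, f x \in B} -> (#|A| <= #|B|)%N.
Proof.
move=> f_inj fAB; rewrite -(card_in_imset f_inj); apply: subset_leq_card.
by apply/subsetP => _ /imsetP[x Ax ->]; apply: fAB.
Qed.

Section Sparsity.
Variables (F : numClosedFieldType) (gT : finGroupType) (G H : {group gT}).
Variables (W : irr_family F G) (V : irr_family F H).
Variables (blk : irr_basis W -> nat) (pos : irr_basis W -> irr_basis V).
Hypotheses (sHG : H \subset G) (adWV : adapted blk pos).
Implicit Types x y z : irr_basis W.

(* Schur's lemma: [s] commutes with the image of the element of the algebra of
   [H] that acts on the members of [V] as the matrix unit at [pos x]. *)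
Lemma irr_coef_centraliser s x y : s \in G -> s \in 'C(H)%g ->
  irr_coef s x y != 0 -> tag x = tag y /\ pos x = pos y.
Proof.
move=> Gs cHs nz; have [bWV _] := adWV.
split; first by apply: contraNeq nz => /irr_coef_off ->.
have [a aT] := irr_coef_solve V (fun u v => ((u == v) && (u == pos x))%:R).
(* Block diagonality turns the matrix unit into a projection in [W]: it keeps the basis vectors over
   [pos x] and kills the others. *)
have aP u v : \sum_(h in H) a h * irr_coef h u v = ((u == v) && (pos u == pos x))%:R.
  transitivity (if blk u == blk v then ((pos u == pos v) && (pos u == pos x))%:R
                else 0 : F).
    have [uv|uv] := eqVneq (blk u) (blk v); last first.
      rewrite big1 // => h Hh; rewrite (blocks_coef bWV) //.
      by rewrite (negPf uv) mulr0.
    rewrite -aT ?(blocks_tag bWV uv) //.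
    by apply: eq_bigr => h Hh; rewrite (blocks_coef bWV) // uv eqxx.
  have [uv|] := eqVneq (blk u) (blk v); last first.
    by have [->|//] := eqVneq u v; rewrite eqxx.
  have [puv|puv] := eqVneq (pos u) (pos v).
    by rewrite (blocks_inj bWV uv puv) eqxx.
  by case: (u =P v) puv => // ->; rewrite eqxx.
have sumL : \sum_(h in H) a h * irr_coef (s * h)%g x y
    = irr_coef s x y * (pos y == pos x)%:R.
  transitivity (\sum_z irr_coef s x z * \sum_(h in H) a h * irr_coef h z y).
    rewrite (eq_bigr (fun h => \sum_z irr_coef s x z * (a h * irr_coef h z y))).
      by rewrite exchange_big /=; apply: eq_bigr => z _; rewrite mulr_sumr.
    move=> h Hh; have Gh := subsetP sHG h Hh; rewrite irr_coefM // mulr_sumr.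
    by apply: eq_bigr => z _; rewrite mulrCA.
  rewrite (bigD1 y) //= aP eqxx big1 ?addr0 // => z /negPf zy.
  by rewrite aP zy mulr0.
have sumR : \sum_(h in H) a h * irr_coef (h * s)%g x y = irr_coef s x y.
  transitivity (\sum_z (\sum_(h in H) a h * irr_coef h x z) * irr_coef s z y).
    rewrite (eq_bigr (fun h => \sum_z a h * irr_coef h x z * irr_coef s z y)).
      by rewrite exchange_big /=; apply: eq_bigr => z _; rewrite mulr_suml.
    move=> h Hh; have Gh := subsetP sHG h Hh; rewrite irr_coefM // mulr_sumr.
    by apply: eq_bigr => z _; rewrite mulrA.
  rewrite (bigD1 x) //= aP !eqxx mul1r big1 ?addr0 // => z /negPf zx.
  by rewrite aP eq_sym zx mul0r.
(* The products of [s] with this projection in the two orders agree, since [s] commutes with [H]. *)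
have : irr_coef s x y * (pos y == pos x)%:R = irr_coef s x y.
  rewrite -sumL -[RHS]sumR; apply: eq_bigr => h Hh.
  by rewrite (centP cHs).
by case: eqP => [->//|_]; rewrite mulr0 => /esym/eqP; rewrite (negPf nz).
Qed.

(* [#|J y|] is the multiplicity of a member of [V], of degree [#|E y|], in a
   member of [W], of degree [#|D y|]. *)
Let J y := [set x | (tag x == tag y) && (pos x == pos y)].
Let D y := [set x : irr_basis W | tag x == tag y].
Let E y := [set w : irr_basis V | tag w == tag (pos y)].

(** A vector of [J y] selects a block and one of [E y] a position in it; the basis vector found
    there determines both. *)
Let card_JE y : (#|J y| * #|E y| <= #|D y|)%N.
Proof.
have [[_ bt bi bf] tW] := adWV.
pose f (p : irr_basis W * irr_basis V) :=
  odflt p.1 [pick x | (blk x == blk p.1) && (pos x == p.2)].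
have fP p : p \in setX (J y) (E y) -> blk (f p) = blk p.1 /\ pos (f p) = p.2.
  case: p => j w; rewrite !inE /= => /andP[/andP[_ /eqP pj] /eqP tw].
  rewrite /f /=; case: pickP => [x /andP[/eqP -> /eqP ->] //|].
  have [|x xj xw] := bf j w; first by rewrite pj.
  by move/(_ x); rewrite xj xw !eqxx.
rewrite -cardsX; apply: (leq_card_in_set (f := f)) => [p q Jp Jq fpq|p Jp].
  have [[bp pp] [bq pq]] := (fP p Jp, fP q Jq).
  move: Jp Jq; rewrite !inE => /andP[/andP[_ /eqP pj] _] /andP[/andP[_ /eqP qj] _].
  rewrite [p]surjective_pairing [q]surjective_pairing -pp -pq fpq.
  by congr (_, _); apply: bi; rewrite ?pj ?qj // -bp -bq fpq.
have [bp _] := fP p Jp; move: Jp; rewrite !inE => /andP[/andP[/eqP <- _] _].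
by rewrite (tW _ _ bp).
Qed.

(* The columns [J y] of the elements of the algebra of [G] fill a space of
   dimension [#|D y| * #|J y|], but over each coset of [H] they are spanned by
   the [#|E y|] coefficients of a column of a member of [V]. *)
Let card_DJ y : (#|D y| * #|J y| <= #|G : H|%g * #|E y|)%N.
Proof.
have [[bc bt bi bf] tW] := adWV.
have onto : coef_onto (setX (D y) (J y)) G
    (fun p g => irr_coef g p.1 p.2 : F).
  move=> T; have [a aT] := irr_coef_onto W T; exists a => p Dp; apply: aT.
  by move: Dp; rewrite !inE => /andP[/eqP -> /andP[/eqP ->]].
rewrite -card_lcosets -!cardsX.
(* Writing [g] as its coset representative times an element of [H] factors the coefficients through
   pairs of a coset and a vector of [E y]. *)
pose P (p : irr_basis W * irr_basis W) (k : {set gT} * irr_basis V) : F :=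
  \sum_(z | (blk z == blk p.2) && (pos z == k.2)) irr_coef (repr k.1) p.1 z.
pose Q (k : {set gT} * irr_basis V) g : F :=
  irr_coef ((repr k.1)^-1 * g)%g k.2 (pos y) *+ (k.1 == g *: H)%g.
apply: (coef_onto_leq (P := P) (Q := Q) _ onto) => -[x j] g /=.
rewrite !inE /= => /andP[_ /andP[_ /eqP pj]] Gg.
pose r := repr (g *: H)%g; pose h := (r^-1 * g)%g.
have Hh : h \in H.
  rewrite -groupV invMg invgK -mem_lcoset.
  by rewrite (mem_repr g) ?lcoset_refl.
have Gr : r \in G by rewrite -(groupMr r (subsetP sHG h Hh)) mulKVg.
have Gh := subsetP sHG h Hh.
transitivity (\sum_(z | blk z == blk j) irr_coef r x z * irr_coef h (pos z) (pos y)).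
  rewrite -[in LHS](mulKVg r g) -/h irr_coefM // (bigID (fun z => blk z == blk j)) /=.
  rewrite [X in _ + X]big1 ?addr0 => [|z /negPf zj]; last by rewrite (bc h) // zj mulr0.
  by apply: eq_bigr => z zj; rewrite (bc h) // zj pj.
rewrite (partition_big pos (mem (E y))) /= => [|z /eqP /bt zj]; last first.
  by rewrite inE -pj zj.
rewrite (eq_bigl (fun k => (k.1 \in lcosets H G) && (k.2 \in E y))); last first.
  by case=> c w; rewrite in_setX.
rewrite -(pair_big (mem (lcosets H G)) (mem (E y))
  (fun c w => P (x, j) (c, w) * Q (c, w) g)) /= (bigD1 (g *: H)%g) /=; last first.
  by apply/lcosetsP; exists g.
rewrite [X in _ = _ + X]big1 ?addr0 => [|c /andP[_ /negPf cg]]; last first.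
  by rewrite big1 // => w _; rewrite /Q cg mulr0n mulr0.
apply: eq_bigr => w _; rewrite /P /Q /= eqxx mulr_suml.
by apply: eq_bigr => z /andP[_ /eqP ->].
Qed.

(** If m, e, d are the sizes of [J y], [E y], [D y], then m e <= d and d m <= [#|G : H|] e, so even
    m ^ 2 is at most the index. *)
Lemma card_multiplicity y :
  (#|[set x | (tag x == tag y) && (pos x == pos y)]| <= #|G : H|%g)%N.
Proof.
have E_gt0 : (0 < #|E y|)%N by rewrite (cardD1 (pos y)) inE eqxx.
have le : (#|J y| ^ 2 <= #|G : H|%g)%N.
  rewrite -(leq_pmul2r E_gt0) (leq_trans _ (card_DJ y)) // expnS expn1.
  by rewrite -mulnA mulnC leq_mul2r card_JE orbT.
apply: leq_trans le; rewrite -/(J y); case: #|J y| => // k.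
by rewrite expnS expn1 leq_pmulr.
Qed.

End Sparsity.

(** * Costs of straight-line programs *)

Section Reach.
Variables (K : pzSemiRingType) (I : Type).
Local Notation functional := ((I -> K) -> K).
Implicit Types (p q : program K I) (g : functional) (S T U : functional -> Prop).

Lemma size_run p f : size (run p f) = size p.
Proof.
rewrite /run -[size p]add0n -[in RHS](_ : size ([::] : seq K) = 0%N) //.
elim: p [::] => [|[[a b] c] p IHp] w /=; first by rewrite addn0.
by rewrite IHp size_rcons addSnnS.
Qed.

Lemma run_cat p q f : exists w, run (p ++ q) f = run p f ++ w.
Proof.
rewrite /run foldl_cat; move: (foldl _ _ p) => v.
elim: q v => [|[[a b] c] q IHq] v /=; first by exists [::]; rewrite cats0.
have [w ->] := IHq (rcons v (operand_value f v a * operand_value f v b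
                             + operand_value f v c)).
by rewrite cat_rcons; eexists.
Qed.

Lemma computes_catl p q g : computes p g -> computes (p ++ q) g.
Proof.
case=> [[i|k|j] gP].
- by exists (Input K i) => f; rewrite gP.
- by exists (Const I k) => f; rewrite gP.
have [jp|pj] := ltnP j (size p).
  exists (Step K I j) => f; rewrite gP /=; have [w ->] := run_cat p q f.
  by rewrite nth_cat size_run jp.
(* An index beyond [p] reads as 0 but could name a genuine step of [p ++ q], so a constant replaces
   it. *)
by exists (Const I 0) => f; rewrite gP /= nth_default // size_run.
Qed.

(* Whatever has been computed so far, [N] further steps turn the values of the
   functionals in [S] into those of the functionals in [T]. *)
Definition reach N S T : Prop := forall p, (forall g, S g -> computes p g) ->
  exists2 q, (size q <= N)%N & forall g, T g -> computes (p ++ q) g.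

Lemma reach_le M N S T : (M <= N)%N -> reach M S T -> reach N S T.
Proof. by move=> MN r p /r[q qM qT]; exists q; rewrite ?(leq_trans qM). Qed.

Lemma reach_subl N S S' T : (forall g, S g -> S' g) -> reach N S T -> reach N S' T.
Proof. by move=> SS' r p pS'; apply: r => g /SS'/pS'. Qed.

Lemma reach_sub S T : (forall g, T g -> S g \/ g = fun=> 0) -> reach 0 S T.
Proof.
move=> TS p pS; exists [::] => // g /TS[/pS|->]; rewrite cats0 //.
by exists (Const I 0).
Qed.

Lemma reach_subr N S T T' : (forall g, T' g -> T g \/ g = fun=> 0) ->
  reach N S T -> reach N S T'.
Proof.
move=> TT' r p /r[q qN qT]; exists q => // g /TT'[/qT //|->].
by exists (Const I 0).
Qed.

(** The values in [S] remain available to the second stage, because appending steps preserves what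
    is computed. *)
Lemma reach_trans M N S T U :
  reach M S T -> reach N (fun g => S g \/ T g) U -> reach (M + N) S U.
Proof.
move=> rM rN p pS; have [q qM qT] := rM p pS.
have pqST g : S g \/ T g -> computes (p ++ q) g.
  by case=> [/pS/computes_catl|/qT].
have [q' q'N q'U] := rN _ pqST.
by exists (q ++ q'); rewrite ?size_cat ?leq_add // catA.
Qed.

Lemma reach_bigU (J : finType) (P : pred J) (N : J -> nat) S
    (T : J -> functional -> Prop) : (forall j, P j -> reach (N j) S (T j)) ->
  reach (\sum_(j | P j) N j) S (fun g => exists2 j, P j & T j g).
Proof.
move=> rT; suff : reach (\sum_(j <- enum P) N j) S
    (fun g => exists2 j, j \in enum P & T j g).
  rewrite big_enum => r p /r[q qN qT]; exists q => // g [j Pj Tj].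
  by apply: qT; exists j; rewrite ?mem_enum.
have : {subset enum P <= P} by move=> j; rewrite mem_enum.
elim: (enum P) => [|j r IHr] rP.
  by move=> p _; exists [::] => // g [j].
rewrite big_cons; apply: reach_trans (rT j (rP j (mem_head _ _))) _.
move=> p pST; have rP' : {subset r <= P}.
  by move=> k kr; apply: rP; rewrite inE kr orbT.
have [q qN qT] := IHr rP' p (fun g Sg => pST g (or_introl Sg)).
exists q => // g [k]; rewrite inE => /predU1P[-> Tj|kr Tk]; last first.
  by apply: qT; exists k.
by apply/computes_catl/pST; right.
Qed.

(** One step per term suffices: each adds a multiple to the running sum, which starts from the
    constant 0. *)
Lemma reach_lincomb (J : finType) (P : pred J) (c : J -> K) (u : J -> functional)
    S : (forall j, P j -> S (u j)) ->
  reach #|P| S (eq (fun f => \sum_(j | P j) c j * u j f)).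
Proof.
move=> uS p pS.
suff [q qN [src srcP]] : exists2 q, size q = size (enum P) &
    computes (p ++ q) (fun f => \sum_(j <- enum P) c j * u j f).
  exists q => [|_ <-]; first by rewrite qN -cardE.
  by exists src => f; rewrite -srcP big_enum.
have : {subset enum P <= P} by move=> j; rewrite mem_enum.
elim: (enum P) => [|j r IHr] rP.
  by exists [::] => //; exists (Const I 0) => f; rewrite big_nil.
have rP' : {subset r <= P}.
  by move=> k kr; apply: rP; rewrite inE kr orbT.
have [q qr [src srcP]] := IHr rP'.
have [arg argP] : computes (p ++ q) (u j).
  by apply/computes_catl/pS/uS/rP/mem_head.
exists (rcons q (Const I (c j), arg, src)); first by rewrite size_rcons qr.
exists (Step K I (size (p ++ q))) => f; rewrite -rcons_cat /= big_cons.
rewrite /run foldl_rcons -/(run _ f) /= nth_rcons size_run ltnn eqxx.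
by rewrite -argP srcP.
Qed.

End Reach.

(** * The transform along a chain of groups *)

Lemma big_lcosets (V : nmodType) (gT : finGroupType) (G H : {group gT})
    (r : {set gT} -> gT) (phi : gT -> V) : H \subset G ->
  {in lcosets H G, forall C, C = (r C *: H)%g} ->
  \sum_(g in G) phi g = \sum_(C in lcosets H G) \sum_(h in H) phi (r C * h)%g.
Proof.
move=> sHG rP.
rewrite (partition_big (fun g => g *: H)%g (mem (lcosets H G))) /=; last first.
  by move=> g Gg; apply/lcosetsP; exists g.
apply: eq_bigr => C LC.
rewrite (reindex_onto (fun h => r C * h)%g (fun g => (r C)^-1 * g)%g) /=.
  apply: eq_bigl => h; rewrite mulKg eqxx andbT.
  have /lcosetsP[g Gg Cg] := LC.
  have Gr : r C \in G.
    have : r C \in C by rewrite {2}(rP C LC) lcoset_refl.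
    by rewrite Cg => /lcosetP[h' Hh' ->]; rewrite groupM // (subsetP sHG).
  rewrite [X in _ == X](rP C LC); apply/andP/idP => [[_ /eqP rhr]|Hh].
    have : (r C * h)%g \in (r C * h *: H)%g by apply: lcoset_refl.
    by rewrite rhr mem_lcoset mulKg.
  split; first by rewrite groupM // (subsetP sHG).
  by apply/eqP/lcoset_eqP; rewrite mem_lcoset mulKg.
by move=> g _; rewrite mulKVg.
Qed.

Section ChainTransform.
Variables (F : numClosedFieldType) (gT : finGroupType).
Variables (Gam : nat -> {group gT}) (gen : nat -> gT).
Hypotheses (Gam0 : Gam 0 = 1%G) (GamS : forall k, Gam k \subset Gam k.+1).
Hypothesis index_Gam : forall k, (#|Gam k.+1 : Gam k|%g <= k.+1)%N.
Hypothesis gen_mem : forall j, gen j \in Gam j.+2.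
Hypothesis gen_cent : forall j, gen j \in 'C(Gam j)%g.
Hypothesis gen_coset : forall k g, g \in Gam k.+1 ->
  exists w : seq nat, [/\ (size w <= k)%N, all (fun j => j < k)%N w &
    ((\prod_(j <- w) gen j)^-1 * g)%g \in Gam k].

Variable W : forall k, irr_family F (Gam k).
Hypothesis adapted_step : forall k, exists blk pos,
  @adapted F gT (Gam k.+1) (Gam k) (W k.+1) (W k) blk pos.

Lemma Gam_sub k l : (k <= l)%N -> Gam k \subset Gam l.
Proof.
by move/subnK <-; elim: (l - k)%N => //= m IHm; apply: subset_trans (GamS _).
Qed.

Lemma adapted_le k l : (k <= l)%N ->
  exists blk pos, @adapted F gT (Gam l) (Gam k) (W l) (W k) blk pos.
Proof.
move/subnK <-; elim: (l - k)%N => /= [|m [blk [pos IHm]]].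
  by do 2![eexists]; apply: adapted_refl.
have [blk' [pos' ad]] := adapted_step (m + k).
by do 2![eexists]; apply: adapted_trans ad IHm; apply/Gam_sub/leq_addl.
Qed.

(** The generator is block diagonal over [Gam j.+2], and Schur's lemma over [Gam j] confines a row
    to one multiplicity space. Its dimension is at most the index (j + 2) (j + 1) allows, hence at
    most [k ^ 2]. *)
Lemma card_gen_row k j (x : irr_basis (W k)) : (j.+1 < k)%N ->
  (#|[set y | (irr_coef (gen j) x y != 0)%R]| <= k ^ 2)%N.
Proof.
move=> jk; have [blk [pos [bW tW]]] := adapted_le jk.
have le_j : (j <= j.+2)%N by rewrite !leqW.
have [blk' [pos' ad]] := adapted_le le_j.
pose J := [set y | (tag y == tag (pos x)) && (pos' y == pos' (pos x))].
apply: (@leq_trans #|J|).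
  have rowP y : irr_coef (gen j) x y != 0 ->
      blk x = blk y /\ pos y \in J.
    rewrite (blocks_coef bW) //; case: ifP => [/eqP xy nz|]; last by rewrite eqxx.
    split=> //; rewrite inE.
    have [tx px] := irr_coef_centraliser (Gam_sub le_j) ad (gen_mem j) (gen_cent j) nz.
    by rewrite tx px !eqxx.
  apply: (leq_card_in_set (f := pos)) => [y z|y]; rewrite !inE.
    by move=> /rowP[xy _] /rowP[xz _]; apply: (blocks_inj bW); rewrite -xy xz.
  by move=> /rowP[_]; rewrite inE.
apply: leq_trans (card_multiplicity (Gam_sub le_j) ad (pos x)) _.
rewrite -(Lagrange_index (GamS j.+1) (GamS j)) expnS expn1.
by apply: leq_mul; apply: leq_trans (index_Gam _) _; rewrite // ltnW.
Qed.

(** The fifth power closes the recurrence: going from k to k + 1 adds at most k (k + 1) ^ 3 + (k +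
    1) operations per group element, which is less than (k + 2) ^ 5 - (k + 1) ^ 5. *)
Definition chain_cost k : nat := (k.+1 ^ 5 * #|Gam k|)%N.

Section Functionals.
Variable I : Type.
Local Notation functional := ((I -> F) -> F).
Implicit Types (x : gT -> functional) (S : functional -> Prop).

Definition entries k (M : irr_basis (W k) -> irr_basis (W k) -> functional) :
  functional -> Prop := fun h => exists a b, h = M a b.

(** Entries joining different members vanish, which leaves [#|Gam k|] entries to compute. *)
Lemma reach_entries k N (u : nat) S
    (M : irr_basis (W k) -> irr_basis (W k) -> functional) :
  (u * #|Gam k| <= N)%N ->
  (forall a b, tag a != tag b -> M a b = fun=> 0) ->
  (forall a b, tag a = tag b -> reach u S (eq (M a b))) ->
  reach N S (entries M).
Proof.
move=> uN M0 rM.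
have := @reach_bigU _ I _ (mem (irr_pairs (W k))) (fun=> u) S
  (fun p => eq (M p.1 p.2)).
rewrite sum_nat_const card_irr_pairs mulnC => /(_ _)/(reach_le uN) r.
apply: reach_subr (r _) => [_ [a [b ->]]|p Pp]; last first.
  by apply: rM; have /[!inE]/eqP : p \in irr_pairs (W k) := Pp.
have [ab|/M0] := eqVneq (tag a) (tag b); last by right.
left; exists (a, b) => //; change ((a, b) \in irr_pairs (W k)).
by rewrite inE /= ab.
Qed.

Lemma reach_gen k j (M : irr_basis (W k) -> irr_basis (W k) -> functional) :
  (j.+1 < k)%N -> (forall a b, tag a != tag b -> M a b = fun=> 0) ->
  reach (k ^ 2 * #|Gam k|) (entries M)
    (entries (fun a b f => \sum_c irr_coef (gen j) a c * M c b f)).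
Proof.
move=> jk M0; apply: (reach_entries (u := (k ^ 2)%N)) => // [a b ab|a b _].
  apply/funext => f; rewrite big1 // => c _.
  have [ac|ac] := eqVneq (tag a) (tag c); last by rewrite irr_coef_off ?mul0r.
  by rewrite M0 ?mulr0 // -ac.
apply: reach_le (card_gen_row a jk) _.
set P := finset _.
have -> : (fun f => \sum_c irr_coef (gen j) a c * M c b f) =
    (fun f => \sum_(c in P) irr_coef (gen j) a c * M c b f).
  apply/funext => f; rewrite [RHS]big_mkcond; apply: eq_bigr => c _.
  by rewrite inE; case: eqP => [->|//]; rewrite mul0r.
by apply: reach_lincomb => c _; exists c, b.
Qed.

(** The letters are applied one at a time, starting from the last, each as a product with a sparse
    matrix. *)
Lemma reach_word k (w : seq nat) (A : {set gT}) x :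
  all (fun j => j.+1 < k)%N w -> A \subset Gam k ->
  let r := (\prod_(j <- w) gen j)%g in
  reach (size w * (k ^ 2 * #|Gam k|))
    (@entries k (fun a b f => \sum_(h in A) irr_coef h a b * x h f))
    (@entries k (fun a b f => \sum_(h in A) irr_coef (r * h)%g a b * x h f)).
Proof.
move=> + sAG /=; elim: w => [_|j w IHw /= /andP[jk wk]].
  apply: reach_sub => _ [a [b ->]]; left; exists a, b.
  by apply/funext => f; apply: eq_bigr => h _; rewrite big_nil mul1g.
set r := (\prod_(i <- w) gen i)%g.
have Gr : r \in Gam k.
  rewrite /r big_seq; apply: group_prod => i iw.
  by rewrite (subsetP (Gam_sub (allP wk _ iw))) ?gen_mem.
rewrite mulSn addnC; apply: reach_trans (IHw wk) _.
have r0 (a b : irr_basis (W k)) : tag a != tag b ->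
    (fun f => \sum_(h in A) irr_coef (r * h)%g a b * x h f) = fun=> 0.
  by move=> ab; apply/funext => f; rewrite big1 // => h _; rewrite irr_coef_off ?mul0r.
have := reach_gen jk r0 => {IHw}rr.
apply: (reach_subl (S := @entries k
    (fun a b f => \sum_(h in A) irr_coef (r * h)%g a b * x h f))).
  by move=> h Eh; right.
apply: reach_subr rr => _ [a [b ->]]; left; exists a, b; apply/funext => f.
rewrite big_cons -/r.
under [RHS]eq_bigr do rewrite mulr_sumr.
rewrite exchange_big; apply: eq_bigr => h Ah /=.
rewrite -mulgA irr_coefM; first last.
- by rewrite groupM // (subsetP sAG).
- by rewrite (subsetP (Gam_sub jk)) ?gen_mem.
by rewrite mulr_suml; apply: eq_bigr => c _; rewrite mulrA.
Qed.

Lemma reach_transform k x S : (forall g, g \in Gam k -> S (x g)) ->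
  reach (chain_cost k) S
    (@entries k (fun a b f => \sum_(g in Gam k) irr_coef g a b * x g f)).
Proof.
have off l (A : {set gT}) (y u : gT -> _) (a b : irr_basis (W l)) :
    tag a != tag b ->
    (fun f : I -> F => \sum_(g in A) irr_coef (u g) a b * y g f) = fun=> 0.
  by move=> ab; apply/funext => f; rewrite big1 // => g _; rewrite irr_coef_off ?mul0r.
elim: k x S => [|k IHk] x S xS.
  apply: (reach_entries (u := 1%N)) => [|a b /(off 0%N _ x id)//|a b _].
    by rewrite /chain_cost exp1n.
  apply: (@reach_le _ _ #|mem (Gam 0)|); first by rewrite Gam0 cards1.
  exact: reach_lincomb.
have ex_w C : exists w : seq nat, C \in lcosets (Gam k) (Gam k.+1) ->
    [/\ (size w <= k)%N, all (fun j => j < k)%N w &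
      (C = (\prod_(j <- w) gen j) *: Gam k)%g].
  case: (boolP (C \in _)) => [/lcosetsP[g Gg ->]|]; last by exists [::].
  have [w [wk wj wg]] := gen_coset Gg; exists w; split=> //.
  by apply/lcoset_eqP; rewrite mem_lcoset.
have [w_ wP] := fin_all_exists ex_w.
pose r C := (\prod_(j <- w_ C) gen j)%g.
have rG C : C \in lcosets (Gam k) (Gam k.+1) -> r C \in Gam k.+1.
  move=> LC; have [_ _ rC] := wP C LC.
  have /lcosetsP[g Gg Cg] := LC; have : r C \in C by rewrite {2}rC lcoset_refl.
  by rewrite Cg => /lcosetP[h Hh ->]; rewrite groupM // (subsetP (GamS k)).
pose part (C : {set gT}) (a b : irr_basis (W k.+1)) (f : I -> F) :=
  \sum_(h in Gam k) irr_coef (r C * h)%g a b * x (r C * h)%g f : F.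
have reach_part C : C \in lcosets (Gam k) (Gam k.+1) ->
    reach (chain_cost k + k * (k.+1 ^ 2 * #|Gam k.+1|)) S
      (@entries k.+1 (part C)).
  move=> LC; have [wk wj _] := wP C LC.
  have xC h : h \in Gam k -> S (x (r C * h)%g).
    by move=> Hh; apply: xS; rewrite groupM ?rG // (subsetP (GamS k)).
  apply: reach_trans (IHk (fun h => x (r C * h)%g) S xC) _.
  have := @reach_word k.+1 (w_ C) (Gam k) (fun h => x (r C * h)%g) wj (GamS k).
  move/(reach_le (leq_mul wk (leqnn _))) => rw p pS.
  apply: rw => _ [a [b ->]].
  have [blk [pos [bW _]]] := adapted_step k.
  (* By adaptedness an entry over [W k.+1] on [Gam k] is an entry over [W k] or zero, so this
     passage costs no operation. *)
  have -> : (fun f => \sum_(h in Gam k) irr_coef h a b * x (r C * h)%g f) =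
      if blk a == blk b then
        fun f => \sum_(h in Gam k) irr_coef h (pos a) (pos b) * x (r C * h)%g f
      else fun=> 0.
    case: ifP => ab; apply/funext => f.
      by apply: eq_bigr => h Hh; rewrite (blocks_coef bW) // ab.
    by rewrite big1 // => h Hh; rewrite (blocks_coef bW) // ab mul0r.
  case: ifP => _; last by exists (Const I 0).
  by apply: pS; right; exists (pos a), (pos b).
have card_L : (#|lcosets (Gam k) (Gam k.+1)| <= k.+1)%N.
  by rewrite card_lcosets index_Gam.
apply: (reach_le _ (reach_trans (reach_bigU reach_part) _)); last first.
  apply: (reach_entries (u := k.+1) (leqnn _)) => [a b /(off _ _ x id)//|a b _].
  apply: reach_le card_L _.
  have -> : (fun f => \sum_(g in Gam k.+1) irr_coef g a b * x g f) =
      fun f => \sum_(C in lcosets (Gam k) (Gam k.+1)) 1 * part C a b f.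
    apply/funext => f; under [RHS]eq_bigr do rewrite mul1r.
    by apply: big_lcosets => // C LC; case: (wP C LC).
  apply: (reach_lincomb (P := mem (lcosets _ _)) (fun=> 1) (u := fun C => part C a b)).
  by move=> C LC; right; exists C => //; exists a, b.
rewrite sum_nat_const card_lcosets /chain_cost -(Lagrange (GamS k)).
move: (index_Gam k); set q := #|_ : _|%g; set g := #|Gam k| => qk.
rewrite mulnDr [(k.+2 ^ 5 * _)%N](_ : _ = (k.+2 ^ 5 * g * q)%N) ?mulnA //.
nia.
Qed.

End Functionals.
End ChainTransform.

(** * The chain of symmetric groups *)

Section SymmetricChain.
Variable n : nat.
Local Open Scope nat_scope.
Local Open Scope group_scope.
Implicit Types (g h : 'S_n) (i : 'I_n) (j k : nat).

(** The symmetric group on the first k points, kept inside ['S_n] so that the whole chain has one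
    ambient type; it is all of ['S_n] once k >= n. *)
Definition sym_below k : {set 'S_n} :=
  [set g : 'S_n | [forall i : 'I_n, (k <= i) ==> (g i == i)]].

Lemma sym_belowP k g :
  reflect (forall i : 'I_n, k <= i -> g i = i) (g \in sym_below k).
Proof.
rewrite inE; apply: (iffP forallP) => [gP i ki|gP i].
  by have /implyP/(_ ki)/eqP := gP i.
by apply/implyP => /gP ->.
Qed.

Fact sym_below_group_set k : group_set (sym_below k).
Proof.
apply/group_setP; split=> [|g h /sym_belowP gP /sym_belowP hP].
  by apply/sym_belowP => i _; rewrite perm1.
by apply/sym_belowP => i ki; rewrite permM gP ?hP.
Qed.
Canonical sym_below_group k := Group (sym_below_group_set k).

Lemma sym_below0 : sym_below_group 0 = 1%G.
Proof.
apply/val_inj/setP => g; rewrite [RHS]inE; apply/sym_belowP/eqP => [gP|-> i _].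
  by apply/permP => i; rewrite perm1 gP.
by rewrite perm1.
Qed.

Lemma sym_belowS k : sym_below_group k \subset sym_below_group k.+1.
Proof. by apply/subsetP => g /sym_belowP gP; apply/sym_belowP => i /ltnW/gP. Qed.

Lemma sym_below_leq k g i : g \in sym_below k -> i < k -> g i < k.
Proof.
move=> /sym_belowP gP ik; rewrite ltnNge; apply/negP => kgi.
have /perm_inj gi := gP _ kgi.
by move: kgi; rewrite gi leqNgt ik.
Qed.

(* This is [1] when [j.+1] is not less than [n]. *)
Definition adjacent j : 'S_n :=
  match insub j, insub j.+1 with Some a, Some b => tperm a b | _, _ => 1 end.

Lemma adjacent_mem j : adjacent j \in sym_below_group j.+2.
Proof.
rewrite /adjacent; case: insubP => [a _ /= aj|_]; last exact: group1.
case: insubP => [b _ /= bj|_]; last exact: group1.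
apply/sym_belowP => i ji; rewrite tpermD //; apply/eqP => /(congr1 val) /=; lia.
Qed.

Lemma adjacent_cent j : adjacent j \in 'C(sym_below_group j).
Proof.
rewrite /adjacent; case: insubP => [a _ /= aj|_]; last exact: group1.
case: insubP => [b _ /= bj|_]; last exact: group1.
apply/centP => g /sym_belowP gP; apply/commgP/conjg_fixP.
by rewrite tpermJ !gP //; lia.
Qed.

Lemma adjacent_prodE m i : i + m < n ->
  val ((\prod_(j <- iota i m) adjacent j) i) = (i + m)%N.
Proof.
elim: m i => [|m IHm] i im; first by rewrite big_nil perm1 addn0.
have i1 : i.+1 < n by lia.
rewrite /= big_cons permM /adjacent valK insubT /= tpermL.
by rewrite (IHm (Ordinal i1)) /=; lia.
Qed.

(** Both [g] and the word carry the preimage i of k under [g] to k, so their quotient fixes k. When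
    n <= k the two groups coincide and i = k gives the empty word. *)
Lemma adjacent_coset k g : g \in sym_below_group k.+1 ->
  exists2 i, i <= k &
    (\prod_(j <- iota i (k - i)) adjacent j)^-1 * g \in sym_below_group k.
Proof.
move=> Gg; have [nk|kn] := leqP n k.
  exists k => //; rewrite subnn big_nil invg1 mul1g.
  by apply/sym_belowP => i ki; have := ltn_ord i; lia.
pose i := g^-1 (Ordinal kn).
have ik : i <= k.
  by rewrite -ltnS; apply: sym_below_leq; rewrite ?groupV.
exists i => //; set r := \prod_(_ <- _) _.
have Gr : r \in sym_below_group k.+1.
  rewrite /r big_seq; apply: group_prod => j; rewrite mem_iota => jP.
  apply/sym_belowP => l kl; have /sym_belowP -> // := adjacent_mem j; lia.
have rk : r^-1 (Ordinal kn) = i.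
  apply: (canLR (permK r)); apply/val_inj; rewrite adjacent_prodE ?subnKC //=; lia.
apply/sym_belowP => l; rewrite leq_eqVlt => /orP[/eqP kl|kl].
  have -> : l = Ordinal kn by apply/val_inj.
  by rewrite permM rk /i permKV.
have /sym_belowP := groupM (groupVr Gr) Gg; exact.
Qed.

Lemma adjacent_word k g : g \in sym_below_group k.+1 -> exists w : seq nat,
  [/\ size w <= k, all (fun j => j < k) w &
    (\prod_(j <- w) adjacent j)^-1 * g \in sym_below_group k].
Proof.
move=> /adjacent_coset[i ik rg]; exists (iota i (k - i)); split=> //.
  by rewrite size_iota leq_subr.
by apply/allP => j; rewrite mem_iota subnKC // => /andP[].
Qed.

Lemma index_sym_below k : #|sym_below_group k.+1 : sym_below_group k| <= k.+1.
Proof.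
rewrite -card_lcosets -[X in _ <= X]card_ord.
pose f (i : 'I_k.+1) :=
  (\prod_(j <- iota i (k - i)) adjacent j) *: sym_below_group k.
apply: leq_trans (leq_imset_card f predT); apply: subset_leq_card.
apply/subsetP => _ /lcosetsP[g Gg ->].
have [i ik rg] := adjacent_coset Gg; apply/imsetP.
by exists (inord i) => //; rewrite /f inordK //; apply/lcoset_eqP; rewrite mem_lcoset.
Qed.

End SymmetricChain.

(** * Restrictions of partial injections *)

Section Match.
Local Open Scope nat_scope.

(** Listing [D] before its complement gives the permutation. Such frames let bijections between
    subsets of equal size be recorded as permutations. *)
Lemma set_frame n (D : {set 'I_n}) :
  exists p : 'S_n, forall i : 'I_n, (p i \in D) = (i < #|D|).
Proof.
pose r := enum D ++ enum (~: D).
have size_r : size r = n by rewrite size_cat -!cardE cardsC card_ord.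
have uniq_r : uniq r.
  rewrite cat_uniq !enum_uniq andbT /=; apply/hasPn => i.
  by rewrite !mem_enum inE.
have r_inj : injective (fun i : 'I_n => nth i r i).
  move=> i j /eqP; rewrite (set_nth_default i j) ?size_r ?ltn_ord //.
  by rewrite nth_uniq ?size_r ?ltn_ord // => /eqP/val_inj.
exists (perm r_inj) => i; rewrite permE nth_cat -cardE.
case: ltnP => iD; first by rewrite -mem_enum mem_nth // -cardE.
apply: negbTE; rewrite -in_setC -mem_enum mem_nth //.
by rewrite -cardE ltn_subLR // cardsC card_ord.
Qed.

Variable n : nat.
Implicit Types (s t : rook n) (D E : {set 'I_n}) (g h : 'S_n) (i j : 'I_n).

Definition frame : {set 'I_n} -> 'S_n :=
  sval (boolp.cid (fin_all_exists (@set_frame n))).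

Lemma frameP D i : (frame D i \in D) = (i < #|D|).
Proof. exact: svalP (boolp.cid (fin_all_exists (@set_frame n))) D i. Qed.

Lemma frameV D i : ((frame D)^-1%g i < #|D|) = (i \in D).
Proof. by rewrite -frameP permKV. Qed.

(* [s] maps [D] onto [E], and [h] is the inverse of the permutation of
   {0, ..., #|D| - 1} that this bijection becomes in the two frames. *)
Definition matches s E D h : bool :=
  [&& #|E| == #|D|, h \in sym_below n #|D| &
    [forall i : 'I_n, (i < #|D|) ==> (val s (frame D (h i)) == Some (frame E i))]].

Lemma matchesP s E D h : reflect
  [/\ #|E| = #|D|, h \in sym_below n #|D| &
    forall i, i < #|D| -> val s (frame D (h i)) = Some (frame E i)]
  (matches s E D h).
Proof.
apply: (iffP and3P) => [[/eqP cE Gh /forallP sP]|[cE Gh sP]]; split=> //.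
- by move=> i iD; have /implyP/(_ iD)/eqP := sP i.
- exact/eqP.
by apply/forallP => i; apply/implyP => /sP ->.
Qed.

Lemma matchesE s E D h i : matches s E D h -> i \in D ->
  val s i = Some (frame E (h^-1 ((frame D)^-1 i)))%g.
Proof.
case/matchesP => cE Gh sP iD; rewrite -sP ?permKV //.
by rewrite sym_below_leq ?groupV // frameV.
Qed.

Definition rook_image s D : {set 'I_n} :=
  [set j | [exists i in D, val s i == Some j]].

Lemma matches_image s E D h : matches s E D h -> E = rook_image s D.
Proof.
move=> m; have [cE Gh sP] := matchesP _ _ _ _ m.
apply/setP => j; rewrite inE; apply/idP/exists_inP => [jE|[i iD]].
  have kj : ((frame E)^-1 j < #|D|)%g by rewrite -cE frameV.
  exists (frame D (h ((frame E)^-1 j)))%g.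
    by rewrite frameP sym_below_leq.
  by rewrite sP // permKV.
rewrite (matchesE m iD) => /eqP[<-].
by rewrite frameP cE sym_below_leq ?groupV // frameV.
Qed.

(** The restriction of [s] to [D] fixes both the image and the permutation read in the frames;
    beyond [#|D|] both permutations are the identity. *)
Lemma matches_inj s E E' D h h' :
  matches s E D h -> matches s E' D h' -> E = E' /\ h = h'.
Proof.
move=> m m'; have EE' : E = E' by rewrite (matches_image m) (matches_image m').
split=> //; rewrite -EE' in m'; apply/permP => i.
have [[_ Gh sP] [_ Gh' sP']] := (matchesP _ _ _ _ m, matchesP _ _ _ _ m').
have [iD|Di] := ltnP i #|D|; last first.
  by rewrite (sym_belowP _ _ Gh) // (sym_belowP _ _ Gh').
apply: (@perm_inj _ (frame D)); apply: (@rook_inj _ s); first by rewrite sP.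
by rewrite sP // sP'.
Qed.

Lemma matches_dom s E D h : matches s E D h -> D \subset rook_dom s.
Proof. by move=> m; apply/subsetP => i iD; rewrite inE (matchesE m iD). Qed.

Lemma matches_exists s D : D \subset rook_dom s -> exists E h, matches s E D h.
Proof.
move=> /subsetP sD; pose E := rook_image s D.
have sE i : i \in D -> exists2 j, val s i = Some j & j \in E.
  move=> iD; have := sD i iD; rewrite inE; case si : (val s i) => [j|] // _.
  by exists j; rewrite // inE; apply/exists_inP; exists i; rewrite // si.
have cE : #|E| = #|D|.
  pose f i := odflt i (val s i).
  have -> : E = f @: D.
    apply/setP => j; rewrite inE; apply/exists_inP/imsetP => -[i iD].
      by move=> /eqP si; exists i; rewrite // /f si.
    by have [j' si _] := sE i iD; rewrite /f si /= => ->; exists i; rewrite ?si.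
  apply: card_in_imset => i i' /sE[j si _] /sE[j' si' _]; rewrite /f si si' /=.
  by move=> jj'; apply: (@rook_inj _ s); rewrite si // si' jj'.
(* The bijection from [D] to [E] read in the two frames, extended by the identity; its inverse is
   the required permutation. *)
pose g (i : 'I_n) := if i < #|D| then
  (frame E)^-1%g (odflt i (val s (frame D i))) else i.
have gE i : i < #|D| -> val s (frame D i) = Some (frame E (g i)) /\ g i < #|D|.
  move=> iD; have [|j sj jE] := sE (frame D i); first by rewrite frameP.
  by rewrite /g iD sj /= permKV -cE frameV.
have g_id i : #|D| <= i -> g i = i by rewrite /g ltnNge => ->.
have g_inj : injective g.
  move=> i j; have [iD|Di] := ltnP i #|D|; have [jD|Dj] := ltnP j #|D|.
  - have [[si _] [sj _]] := (gE i iD, gE j jD) => gij.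
    apply: (@perm_inj _ (frame D)); apply: (@rook_inj _ s); rewrite si // sj.
    by rewrite gij.
  - by rewrite (g_id j) // => gij; have [_] := gE i iD; rewrite gij ltnNge Dj.
  - by rewrite (g_id i) // => gij; have [_] := gE j jD; rewrite -gij ltnNge Di.
  by rewrite !g_id.
have Gg : (perm g_inj)^-1%g \in sym_below n #|D|.
  by rewrite groupV; apply/sym_belowP => i Di; rewrite permE g_id.
exists E, (perm g_inj)^-1%g; apply/matchesP; split=> // i iD.
set j := _ i; have jD : j < #|D| by rewrite sym_below_leq.
have [-> _] := gE j jD; congr (Some (frame E _)).
by rewrite -(permE g_inj) permKV.
Qed.

Lemma matches1 E D h : matches 1%g E D h = (E == D) && (h == 1%g).
Proof.
have m1 : matches 1%g D D 1%g.
  apply/matchesP; split=> [//||i _]; first exact: (group1 (sym_below_group n _)).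
  by rewrite perm1 ffunE.
apply/idP/andP => [m|[/eqP -> /eqP ->] //].
by have [-> ->] := matches_inj m m1.
Qed.

Lemma big_matches (V : nmodType) s E D h (phi : 'S_n -> V) :
  matches s E D h -> (\sum_(h' | matches s E D h') phi h')%R = phi h.
Proof.
move=> m; apply: big_pred1 => h' /=.
by apply/idP/eqP => [m'|-> //]; have [] := matches_inj m' m.
Qed.

(** The inverse built into [matches] reconciles the conventions: partial maps compose from right to
    left, permutations from left to right. *)
Lemma matchesM s t E E' D h1 h2 :
  matches s E E' h1 -> matches t E' D h2 -> matches (s * t)%g E D (h1 * h2)%g.
Proof.
move=> /matchesP[cE Gh1 sP] /matchesP[cE' Gh2 tP].
rewrite cE' in cE Gh1 sP; apply/matchesP; split=> // [|i iD].
  exact: (groupM (G := sym_below_group n _)).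
rewrite permM ffunE tP /= ?sP //; exact: sym_below_leq.
Qed.

Lemma matches_factor s t E D h : matches (s * t)%g E D h -> exists E' h1 h2,
  [/\ matches s E E' h1, matches t E' D h2 & h = (h1 * h2)%g].
Proof.
move=> m; have [cE Gh stP] := matchesP _ _ _ _ m.
have tD : D \subset rook_dom t.
  have /subsetP stD := matches_dom m; apply/subsetP => i /stD.
  by rewrite !inE ffunE; case: (val t i).
have [E' [h2 m2]] := matches_exists tD; have [cE' Gh2 tP] := matchesP _ _ _ _ m2.
exists E', (h * h2^-1)%g, h2; split=> //; last by rewrite mulgKV.
apply/matchesP; rewrite cE'; split=> // [|i iD].
  by apply: (groupM (G := sym_below_group n _)); rewrite ?groupV.
have h2i : (h2^-1 (h i) < #|D|)%g.
  by rewrite !sym_below_leq ?groupV.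
rewrite permM; have := stP i iD; rewrite ffunE.
by rewrite -{1}[h i](permKV h2) tP.
Qed.

(** Each side has at most one term, since the intermediate set must be the image of [D] under
    [t]. *)
Lemma big_matchesM (V : nmodType) s t E D (phi : 'S_n -> V) :
  (\sum_(h | matches (s * t)%g E D h) phi h =
   \sum_E' \sum_(h1 | matches s E E' h1) \sum_(h2 | matches t E' D h2)
     phi (h1 * h2)%g)%R.
Proof.
have [h m|no_m] := pickP (matches (s * t)%g E D); last first.
  rewrite big_pred0 // big1 // => E' _; rewrite big1 // => h1 m1.
  rewrite big1 // => h2 m2.
  by have := no_m (h1 * h2)%g; rewrite /= (matchesM m1 m2).
have [E0 [h1 [h2 [m1 m2 _]]]] := matches_factor m.
rewrite (big_matches _ (matchesM m1 m2)) (bigD1 E0) //=.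
rewrite (big_matches _ m1) (big_matches _ m2) big1 ?GRing.addr0 // => E' E'E0.
rewrite big1 // => h1' _; rewrite big_pred0 // => h2'.
by apply: contraNF E'E0 => m2'; have [->] := matches_inj m2' m2.
Qed.

Lemma card_matches s :
  #|[set p : {set 'I_n} * {set 'I_n} * 'S_n | matches s p.1.1 p.1.2 p.2]|
    <= 2 ^ n.
Proof.
rewrite -[n in 2 ^ n]card_ord -cardsT -card_powerset.
apply: (leq_card_in_set (f := fun p => p.1.2)) => [|p _].
  move=> [[E D] h] [[E' D'] h'] /[!inE] /= m m' DD'.
  by rewrite -DD' in m' *; have [-> ->] := matches_inj m m'.
by rewrite inE subsetT.
Qed.

Definition triples : {set {set 'I_n} * {set 'I_n} * 'S_n} :=
  [set p : {set 'I_n} * {set 'I_n} * 'S_n |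
    (#|p.1.1| == #|p.1.2|) && (p.2 \in sym_below n #|p.1.2|)].

Lemma triple_rook E D h : #|E| = #|D| -> h \in sym_below n #|D| ->
  exists2 s, matches s E D h & rook_dom s = D.
Proof.
move=> cE Gh.
pose f : {ffun 'I_n -> option 'I_n} := [ffun i => if i \in D then
  Some (frame E (h^-1 ((frame D)^-1 i)))%g else None].
have f_inj : partial_injective f.
  apply/forallP => i; apply/forallP => j; apply/implyP; rewrite !ffunE.
  case: ifP => // _; case: ifP => //= _ /eqP[] /perm_inj/perm_inj/perm_inj ->.
  by rewrite eqxx.
pose s : rook n := Sub f f_inj.
have sE i : val s i = if i \in D then
  Some (frame E (h^-1 ((frame D)^-1 i)))%g else None by rewrite SubK ffunE.
exists s; last by apply/setP => i; rewrite inE sE; case: ifP.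
apply/matchesP; split=> // i iD.
by rewrite sE frameP sym_below_leq // !permK.
Qed.

(** The partial injection that realises a triple with domain exactly [D] determines that triple. *)
Lemma card_triples : #|triples| <= #|{: rook n}|.
Proof.
have ex_s p : exists s, p \in triples -> matches s p.1.1 p.1.2 p.2 /\ rook_dom s = p.1.2.
  have [|_] := boolP (p \in triples); last by exists 1%g.
  by rewrite inE => /andP[/eqP cE Gh]; have [s] := triple_rook cE Gh; exists s.
have [f fP] := fin_all_exists ex_s.
rewrite -cardsT; apply: (leq_card_in_set (f := f)) => [|p _]; last by rewrite inE.
move=> [[E D] h] [[E' D'] h'] /fP /= [m dD] /fP /= [m' dD'] ff'.
move: m' dD'; rewrite -ff' dD => m' DD'; rewrite -DD' in m' *.
by have [-> ->] := matches_inj m m'.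
Qed.

End Match.

(** * Representations of the rook monoid *)

Section RookRepresentations.
Variables (F : numClosedFieldType) (n : nat).
Variable W : forall k, irr_family F (sym_below_group n k).
Implicit Types (s t : rook n) (D E : {set 'I_n}).

Definition rook_index : finType :=
  {k : 'I_n.+1 & irr_index F (sym_below_group n k)}.

Definition rook_member (i : rook_index) := W (tag i) (tagged i).

Definition subsets k : {set {set 'I_n}} := [set D : {set 'I_n} | #|D| == k].

Definition rook_space (i : rook_index) : finType :=
  ({D : {set 'I_n} | D \in subsets (tag i)} * 'I_(rdegree (rook_member i)))%type.

Definition rook_degree (i : rook_index) : nat := #|rook_space i|.

(** The sum has at most one term; it is empty unless [s] maps the second subset onto the first. *)
Definition rook_coef i s (x y : rook_space i) : F :=
  \sum_(h | matches s (val x.1) (val y.1) h) rook_member i h x.2 y.2.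

Definition rook_rep i s : 'M[F]_(rook_degree i) :=
  \matrix_(u, v) rook_coef s (enum_val u) (enum_val v).

Lemma rook_coef1 i (x y : rook_space i) : rook_coef 1%g x y = (x == y)%:R.
Proof.
rewrite /rook_coef -pair_eqE /pair_eq -val_eqE.
under eq_bigl do rewrite matches1.
case: (_ == _); last by rewrite big_pred0.
by rewrite big_pred1_eq repr_mx1 mxE.
Qed.

Lemma rook_coefM i s t (x y : rook_space i) :
  rook_coef (s * t)%g x y = \sum_z rook_coef s x z * rook_coef t z y.
Proof.
rewrite /rook_coef big_matchesM.
pose G E' c := (\sum_(h | matches s (val x.1) E' h) rook_member i h x.2 c) *
  (\sum_(h | matches t E' (val y.1) h) rook_member i h c y.2).
rewrite -(pair_bigA _ (fun (E' : {D : {set 'I_n} | D \in subsets (tag i)}) c =>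
  G (\val E') c)) /=.
rewrite -(big_sub (subsets (tag i)) (fun E' => \sum_c G E' c)) /=.
rewrite [LHS](bigID (fun E' => E' \in subsets (tag i))) /=.
(* A match preserves cardinality, so intermediate sets of the wrong size contribute nothing. *)
rewrite [X in _ + X]big1 ?addr0 => [|E' cE']; last first.
  rewrite big1 // => h1 /matchesP[cx _ _]; case/negP: cE'.
  by rewrite inE -cx; have := valP x.1; rewrite inE.
apply: eq_bigr => E'; rewrite inE => /eqP cE'; rewrite /G.
under [RHS]eq_bigr do rewrite big_distrlr /=.
rewrite [RHS]exchange_big /=; apply: eq_bigr => h1 m1.
rewrite [RHS]exchange_big /=; apply: eq_bigr => h2 m2.
have [_ Gh1 _] := matchesP _ _ _ _ m1; have [cy Gh2 _] := matchesP _ _ _ _ m2.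
rewrite repr_mxM ?mxE //; first by rewrite -cE'.
by rewrite -cE' cy.
Qed.

Definition rook_vector (i : rook_index) (x : rook_space i) : irr_basis (W (tag i)) :=
  Tagged (fun l => 'I_(rdegree (W (tag i) l))) x.2.

(** For fixed subsets the monoid transform becomes a group transform of the sums over extensions;
    this is the link to the chain of groups. *)
Lemma sum_rook_coef i (a : rook n -> F) (x y : rook_space i) :
  \sum_s a s * rook_coef s x y =
  \sum_(h in sym_below n (tag i)) irr_coef h (rook_vector x) (rook_vector y) *
    \sum_(s | matches s (val x.1) (val y.1) h) a s.
Proof.
have cy : #|val y.1| = tag i by have := valP y.1; rewrite inE => /eqP.
under eq_bigr do rewrite mulr_sumr.
rewrite (exchange_big_dep (mem (sym_below n (tag i)))) /= => [|s g _ /matchesP[]].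
  apply: eq_bigr => g Gg; rewrite irr_coef_on mulr_sumr.
  by apply: eq_bigr => s _; rewrite mulrC.
by rewrite cy.
Qed.

Lemma rook_rep1 i : rook_rep i 1%g = 1%:M.
Proof. by apply/matrixP => u v; rewrite !mxE rook_coef1 (inj_eq enum_val_inj). Qed.

Lemma rook_repM i s t : rook_rep i (s * t)%g = rook_rep i s *m rook_rep i t.
Proof.
apply/matrixP => u v; rewrite !mxE rook_coefM.
rewrite (reindex _ (onW_bij _ (enum_val_bij (rook_space i)))).
by apply: eq_bigr => w _; rewrite !mxE.
Qed.

Lemma rook_degree_gt0 i : (0 < rook_degree i)%N.
Proof.
rewrite /rook_degree card_prod card_ord card_sig muln_gt0; apply/andP; split.
  by rewrite card_draws card_ord bin_gt0 -ltnS.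
by rewrite -(mxrank_rsim (irr_member_rsim _ _)) irr_degree_gt0.
Qed.

(** For each k the squared degrees add up to ['C(n, k) ^ 2] times k!, the number of triples with
    sets of size k. *)
Lemma sum_rook_degree : (\sum_i rook_degree i ^ 2 <= #|{: rook n}|)%N.
Proof.
apply: leq_trans (card_triples n).
rewrite big_tagged -[X in (_ <= X)%N]sum1_card.
rewrite [X in (_ <= X)%N](partition_big
  (fun p : {set 'I_n} * {set 'I_n} * 'S_n => inord #|p.1.2| : 'I_n.+1) xpredT) //=.
apply: leq_sum => k _.
pose Tk := setX (setX (subsets k) (subsets k)) (sym_below n k).
rewrite (eq_bigl (mem Tk)) => [|p]; last first.
  have Dn : (#|p.1.2| < n.+1)%N.
    by rewrite ltnS (leq_trans (max_card _)) ?card_ord.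
  rewrite /= !inE -val_eqE /= inordK //; have [<-|] := eqVneq #|p.1.2| k.
    by rewrite !andbT.
  by rewrite !andbF.
rewrite sum1_card !cardsX -(sum_rdegree (W k)) big_distrr /=.
apply: leq_sum => i _; rewrite /rook_degree card_prod card_ord card_sig.
by rewrite /rook_member /= expnMn expnS expn1.
Qed.

(* The sum of [a] over the extensions of every partial injection vanishes; hence
   so does [a], by descending induction on the rank. *)
Lemma rook_rep_separating (a : rook n -> F) :
  (forall i u v, \sum_s a s * rook_rep i s u v = 0) -> forall s, a s = 0.
Proof.
move=> a0.
have coef0 i (x y : rook_space i) : \sum_s a s * rook_coef s x y = 0.
  rewrite -[RHS](a0 i (enum_rank x) (enum_rank y)).
  by apply: eq_bigr => s _; rewrite mxE !enum_rankK.
have above0 E D h : #|E| = #|D| -> h \in sym_below n #|D| ->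
    \sum_(s | matches s E D h) a s = 0.
  have Dn : (#|D| < n.+1)%N by rewrite ltnS (leq_trans (max_card _)) ?card_ord.
  set k : 'I_n.+1 := Ordinal Dn => cE.
  have kE : E \in subsets k by rewrite inE cE.
  have kD : D \in subsets k by rewrite inE.
  move=> Gh; have := irr_coef_separate (W k)
    (fun h => \sum_(s | matches s E D h) a s) _ h Gh; apply.
  move=> [l c] [l' d] /= ll'; case: l' / ll' d => d.
  pose i : rook_index := Tagged (fun k : 'I_n.+1 => irr_index F (sym_below_group n k)) l.
  rewrite -[RHS](coef0 i (exist _ E kE, c) (exist _ D kD, d)) sum_rook_coef.
  by apply: eq_bigr => g _; rewrite mulrC.
suff rank0 m s : (n - rook_rank s < m)%N -> a s = 0.
  by move=> s; apply: (rank0 n.+1); rewrite ltnS leq_subr.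
elim: m s => // m IHm s sm.
have [E [h mh]] := matches_exists (subxx (rook_dom s)).
have [cE Gh _] := matchesP _ _ _ _ mh.
(* Every other extension of [s] has larger rank, so only [a s] survives. *)
have := above0 _ _ _ cE Gh; rewrite (bigD1 s) //= big1 ?addr0 // => t /andP[mt ts].
apply: IHm; have sub := matches_dom mt.
have lt : (rook_rank s < rook_rank t)%N.
  apply: proper_card; rewrite properEneq sub andbT.
  apply: contraNneq ts => dst; apply/eqP/val_inj/ffunP => i.
  have [si|] := boolP (i \in rook_dom s).
    by rewrite (matchesE mt si) (matchesE mh si).
  move=> nsi; have := nsi; rewrite {1}dst !inE !negbK => /eqP ->.
  by move: nsi; rewrite inE negbK => /eqP.
have : (rook_rank t <= n)%N by rewrite (leq_trans (max_card _)) ?card_ord.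
by move: lt sm; lia.
Qed.

(** The target has dimension at most [#|rook n|], so the injective transform is surjective. *)
Lemma rook_rep_onto (T : forall i, 'M[F]_(rook_degree i)) :
  exists a : rook n -> F, forall i, \sum_s a s *: rook_rep i s = T i.
Proof.
pose I : finType := {i : rook_index & 'I_(rook_degree i) * 'I_(rook_degree i)}%type.
pose M (p : I) s : F := rook_rep (tag p) s (tagged p).1 (tagged p).2.
have sep : coef_separating [set: I] [set: rook n] M.
  move=> a aM s _; apply: rook_rep_separating => i u v.
  pose p : I := Tagged (fun i => 'I_(rook_degree i) * 'I_(rook_degree i))%type (u, v).
  rewrite -[RHS](aM p (in_setT p)); apply: eq_bigl => t; exact/esym/in_setT.
have [|a aT] := coef_separating_onto _ sep (fun p => T (tag p) (tagged p).1 (tagged p).2).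
  rewrite !cardsT card_tagged sumnE big_map big_enum.
  apply: leq_trans sum_rook_degree; apply: leq_sum => i _.
  by rewrite card_prod !card_ord.
exists a => i; apply/matrixP => u v.
pose p : I := Tagged (fun i => 'I_(rook_degree i) * 'I_(rook_degree i))%type (u, v).
rewrite -[RHS](aT p (in_setT p)) summxE; apply: eq_big => [t|t _].
  exact/esym/in_setT.
by rewrite mxE.
Qed.

End RookRepresentations.

(** * Complete sets of irreducible representations *)

Lemma mul_mx_delta (K : pzRingType) m p q (M : 'M[K]_(m, p)) b (c : 'I_q) :
  M *m delta_mx b c = \sum_x M x b *: delta_mx x c.
Proof.
apply/matrixP => x y; rewrite summxE mxE (bigD1 b) //= (bigD1 x) //=.
rewrite !mxE !eqxx !big1 ?addr0 // => z /negPf zx; rewrite !mxE.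
  by rewrite eq_sym zx mulr0.
by rewrite zx mulr0.
Qed.

Section CompleteIrreps.
Variables (R : realType) (n : nat).
Local Notation C := (R[i]).
Local Notation A := (rook_algebra R n).

Lemma matrix_rep_extend d (r : rook n -> 'M[C]_d) : r 1%g = 1%:M ->
    (forall s t, r (s * t)%g = r s *m r t) ->
  exists rho : matrix_rep R n d, forall a : A, rho a = \sum_s a s *: r s.
Proof.
move=> r1 rM; pose rho (a : A) := \sum_s a s *: r s.
have rho_lin : linear rho.
  move=> k a b; rewrite /rho scaler_sumr -big_split; apply: eq_bigr => s _ /=.
  by rewrite !ffunE scalerDl scalerA.
have rho_mul : monoid_morphism rho.
  split=> [|a b]; first by rewrite /rho rook_basis_delta.
  rewrite /rho rook_conv_sum mulr_suml; apply: eq_bigr => s _.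
  rewrite mulr_sumr; apply: eq_bigr => t _.
  by rewrite rM -[RHS]/(_ *m _) -scalemxAl -scalemxAr scalerA.
pose L := GRing.isLinear.Build C A 'M[C]_d *:%R rho rho_lin.
pose M := GRing.isMonoidMorphism.Build A 'M[C]_d rho rho_mul.
pose rhoLR : matrix_rep R n d := HB.pack rho L M.
by exists rhoLR.
Qed.

Section Family.
Variables (X : finType) (deg : X -> nat) (rho : forall i, matrix_rep R n (deg i)).
Hypothesis deg_gt0 : forall i, (0 < deg i)%N.
Hypothesis rho_onto : forall T : (forall i, 'M[C]_(deg i)),
  exists a : A, forall i, rho i a = T i.
Hypothesis rho_separating : forall a : A, (forall i, rho i a = 0) -> a = 0.

Inductive members : rep_set R n := Member i : members (rho i).

Lemma members_cast d (r : matrix_rep R n d) : members r ->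
  exists i (e : deg i = d), r = eq_rect _ (matrix_rep R n) (rho i) _ e.
Proof. by case=> i; exists i, erefl. Qed.

Let block_of i (M : 'M[C]_(deg i)) j : 'M[C]_(deg j) :=
  if i =P j is ReflectT e then castmx (congr1 deg e, congr1 deg e) M else 0.

Let block_eq i M : @block_of i M i = M.
Proof.
by rewrite /block_of; case: eqP => // e; rewrite (eq_axiomK e) castmx_id.
Qed.

Let block_neq i j M : i != j -> @block_of i M j = 0.
Proof. by rewrite /block_of; case: eqP. Qed.

(** These elements act as [M] in member [i] and as 0 in the others; they supply the matrix units of
    the algebra. *)
Let lift i (M : 'M[C]_(deg i)) : A := sval (boolp.cid (rho_onto (block_of M))).

Let liftE i M j : rho j (@lift i M) = block_of M j.
Proof. exact: svalP (boolp.cid (rho_onto (block_of M))) j. Qed.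

Let rho_inj (a b : A) : (forall i, rho i a = rho i b) -> a = b.
Proof.
move=> ab; apply/eqP; rewrite -subr_eq0; apply/eqP/rho_separating => i.
by rewrite rmorphB /= ab subrr.
Qed.

Let delta_transitive d (v w : 'cV[C]_d) : v != 0 -> exists M, w = M *m v.
Proof.
move=> v0; have [j vj] : exists j, v j 0 != 0.
  apply/existsP; rewrite -negb_forall; apply: contraNN v0 => /forallP v0.
  by apply/eqP/colP => j; rewrite mxE; apply/eqP/v0.
exists (w *m ((v j 0)^-1 *: delta_mx 0 j)).
rewrite -mulmxA -scalemxAl -rowE [row j v]mx11_scalar mxE.
by rewrite scale_scalar_mx mulVf // mulmx1.
Qed.

Let member_irreducible i : irreducible_rep (rho i).
Proof.
split.
  exists 1; rewrite rmorph1; apply/eqP => /matrixP.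
  move=> /(_ (Ordinal (deg_gt0 i)) (Ordinal (deg_gt0 i))) /eqP.
  by rewrite !mxE eqxx oner_eq0.
move=> U subU; have [->|U0] := eqVneq U 0%VS; [by left|right].
apply/eqP; rewrite eqEsubv subvf; apply/subvP => w _.
have [|M ->] := @delta_transitive _ (vpick U) w; first by rewrite vpick0.
by have := subU (lift M) _ (memv_pick U); rewrite liftE block_eq.
Qed.

(** The two rank conditions force equal degrees, after which [P] is square and invertible. *)
Lemma intertwiner_equivalent d d' (phi : matrix_rep R n d)
    (psi : matrix_rep R n d') (P : 'M[C]_(d, d')) (Y : rep_set R n) :
  (forall a, phi a *m P = P *m psi a) -> row_free P^T -> row_full P^T ->
  Y d' psi -> exists2 psi', Y d psi' & equivalent_rep phi psi'.
Proof.
move=> PJ Pfree Pfull Ypsi; have e : d' = d by rewrite -(eqP Pfree); apply/eqP.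
case: d / e phi P PJ Pfree {Pfull} => phi P PJ Pfree.
have uP : P \in unitmx by rewrite -unitmx_tr -row_free_unit.
exists psi => //; exists (invmx P); first by rewrite unitmx_inv.
by move=> a; rewrite invmxK -mulmxA PJ mulKmx.
Qed.

Section Irreducible.
Variables (d : nat) (phi : matrix_rep R n d).
Hypothesis phi_irr : irreducible_rep phi.

Let phi1 : phi 1 != 0.
Proof.
have [[a a0] _] := phi_irr; apply: contraNneq a0 => p1.
by rewrite -[a]mul1r rmorphM /= p1 mul0r.
Qed.

(** The unit of the algebra is the sum of all diagonal matrix units, and [phi] does not kill it. *)
Let phi_unit : exists i c, phi (lift (delta_mx c c : 'M[C]_(deg i))) != 0.
Proof.
apply: boolp.contrapT => no; case/negP: phi1; apply/eqP.
have -> : (1 : A) = \sum_i \sum_c lift (delta_mx c c : 'M[C]_(deg i)).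
  apply: rho_inj => j; rewrite rmorph1 !rmorph_sum (bigD1 j) //=.
  rewrite [X in _ + X]big1 ?addr0 => [|i ij]; last first.
    by rewrite rmorph_sum big1 // => c _ /=; rewrite liftE block_neq.
  rewrite rmorph_sum /= -[1]/(1%:M) [LHS]mx1_sum_delta.
  by apply: eq_bigr => c _; rewrite liftE block_eq.
rewrite !rmorph_sum big1 // => i _; rewrite rmorph_sum big1 //= => c _.
by apply/eqP; apply: boolp.contrapT => /negP nz; apply: no; exists i, c.
Qed.

(* Some diagonal matrix unit of some member is not killed by [phi]; the matrix
   units of its column, applied to a vector, give the columns of an
   intertwiner. *)
Lemma irreducible_member : exists2 psi, members psi & equivalent_rep phi psi.
Proof.
have [i [c nz]] := phi_unit.
pose E b : A := lift (delta_mx b c : 'M[C]_(deg i)).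
have [v Ev0] : exists v : 'cV[C]_d, phi (E c) *m v != 0.
  apply: boolp.contrapT => no; case/negP: nz; apply/eqP.
  apply/matrixP => x j; apply: boolp.contrapT => nzj; apply: no.
  exists (delta_mx j 0); rewrite -colE; apply/eqP => /colP/(_ x).
  by rewrite !mxE; move: nzj; rewrite mxE.
pose P : 'M[C]_(d, deg i) := \matrix_(x, b) (phi (E b) *m v) x 0.
have mulE a b : a * E b = \sum_b' rho i a b' b *: E b'.
  apply: rho_inj => j; rewrite rmorphM linear_sum.
  have [ij|ij] := eqVneq i j; last first.
    rewrite /= [rho j (E b)]liftE block_neq // mulr0 big1 // => b' _.
    by rewrite linearZ /= liftE block_neq ?scaler0.
  case: j / ij; rewrite /= -[_ * _]/(_ *m _) [rho i (E b)]liftE block_eq mul_mx_delta.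
  by apply: eq_bigr => b' _; rewrite linearZ /= [rho i (E b')]liftE block_eq.
have PJ a : phi a *m P = P *m rho i a.
  apply/matrixP => x b; transitivity ((phi (a * E b) *m v) x 0).
    rewrite rmorphM -[_ * _]/(_ *m _) -mulmxA !mxE.
    by apply: eq_bigr => y _; rewrite mxE.
  rewrite mulE linear_sum mulmx_suml summxE mxE; apply: eq_bigr => b' _.
  by rewrite linearZ -scalemxAl !mxE mulrC.
have Pc0 : P *m (delta_mx c 0 : 'cV_(deg i)) != 0.
  apply/eqP => Pc; case/negP: Ev0; apply/eqP/colP => x.
  by move/colP: Pc => /(_ x); rewrite -colE !mxE.
(* A nonzero vector killed by [P] could be moved by the algebra to the basis vector at [c], which
   [P] does not kill. *)
have Pker : row_free P^T.
  rewrite -kermx_eq0; apply/rowV0P => w /sub_kermxP wP.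
  apply/eqP; apply: boolp.contrapT => /negP w0.
  have wT0 : w^T != 0 by rewrite -(trmx0 C) (inj_eq trmx_inj).
  have [M cM] := delta_transitive (delta_mx c 0) wT0.
  case/negP: Pc0; apply/eqP; rewrite cM.
  have := PJ (lift M); rewrite liftE block_eq mulmxA => <-.
  by rewrite -mulmxA -[P *m _]trmxK trmx_mul trmxK wP trmx0 mulmx0.
(* The image of [P] is a nonzero submodule, hence the whole space. *)
have Pfull : row_full P^T.
  pose f : 'Hom('cV[C]_(deg i), 'cV[C]_d) := linfun (mulmx P).
  have [_ /(_ (limg f))[]] := phi_irr.
  - move=> a _ /memv_imgP[w _ ->]; rewrite lfunE /= mulmxA PJ -mulmxA.
    by rewrite -[P *m _](lfunE (mulmx P)) memv_img ?memvf.
  - move=> f0; case/negP: Pc0; rewrite -memv0 -f0.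
    by rewrite -[P *m _](lfunE (mulmx P)) memv_img ?memvf.
  move=> ffull; rewrite -sub1mx; apply/row_subP => j; apply/submxP.
  have /memv_imgP[w _ jw] : (row j 1%:M)^T \in limg f by rewrite ffull memvf.
  by exists w^T; rewrite -trmx_mul -[row j _]trmxK jw lfunE.
exact: intertwiner_equivalent PJ Pker Pfull (Member i).
Qed.

(** For distinct members some algebra element acts as the identity in one and as 0 in the other,
    while equivalence preserves acting as the identity. *)
Lemma member_unique psi psi' : members psi -> equivalent_rep phi psi ->
  members psi' -> equivalent_rep phi psi' -> psi = psi'.
Proof.
have eqv (r : matrix_rep R n d) a : equivalent_rep phi r ->
    (phi a = 1%:M <-> r a = 1%:M).
  case=> P uP rP; rewrite rP; split=> [->|PP]; first by rewrite mulmx1 mulmxV.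
  have -> : phi a = invmx P *m (P *m phi a *m invmx P) *m P.
    by rewrite -!mulmxA mulVmx // mulmx1 mulKmx.
  by rewrite PP mulmx1 mulVmx.
move=> /members_cast[i [e ->]] ei /members_cast[j [e' ->]] ej.
have [ij|ij] := eqVneq i j.
  by case: j / ij e' ej => e' _; rewrite (eq_irrelevance e e').
pose a := lift (1%:M : 'M[C]_(deg i)).
have /(eqv _ a ei)/(eqv _ a ej) : eq_rect _ (matrix_rep R n) (rho i) _ e a = 1%:M.
  by case: d / e {ei ej e'} => /=; rewrite liftE block_eq.
have -> : eq_rect _ (matrix_rep R n) (rho j) _ e' a = 0.
  by case: d / e' {ei ej e eqv} => /=; rewrite liftE block_neq.
move=> d1; case/negP: phi1; apply/eqP.
by rewrite rmorph1 -[1]/(1%:M) -d1.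
Qed.
End Irreducible.

Theorem members_complete : complete_irreps members.
Proof.
split=> [d _ [k]|d phi phi_irr]; first exact: member_irreducible.
have [psi mpsi epsi] := irreducible_member phi_irr.
exists psi; split=> // psi' [mpsi' epsi'].
exact: member_unique mpsi epsi mpsi' epsi'.
Qed.

End Family.
End CompleteIrreps.

(** * The cost of the transform *)

Section RookTransform.
Variables (F : numClosedFieldType) (n : nat).
Variable W : forall k, irr_family F (sym_below_group n k).
Hypothesis W_adapted : forall k, exists blk pos,
  @adapted F _ (sym_below_group n k.+1) (sym_below_group n k) (W k.+1) (W k) blk pos.
Implicit Types (s : rook n) (D E : {set 'I_n}).

Definition extension_sum E D h (f : rook n -> F) : F :=
  \sum_(s | matches s E D h) f s.

(** Terms are counted by partial injection: each occurs in at most 2 ^ n of the sums. *)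
Lemma reach_extension_sums :
  reach (2 ^ n * #|{: rook n}|) (fun g => exists s, g = fun f : rook n -> F => f s)
    (fun g => exists E D h, g = extension_sum E D h).
Proof.
pose N (p : {set 'I_n} * {set 'I_n} * 'S_n) :=
  #|[pred s | matches s p.1.1 p.1.2 p.2]|.
apply: (@reach_le _ _ (\sum_p N p)).
  rewrite /N; under eq_bigr do rewrite -sum1_card big_mkcond.
  rewrite exchange_big /= mulnC -sum_nat_const; apply: leq_sum => s _.
  apply: leq_trans (card_matches s); rewrite -big_mkcond sum1_card.
  by apply: eq_leq; apply: eq_card => p; rewrite !inE.
have rN (p : {set 'I_n} * {set 'I_n} * 'S_n) : xpredT p ->
    reach (N p) (fun g => exists s, g = fun f : rook n -> F => f s)
      (eq (extension_sum p.1.1 p.1.2 p.2)).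
  move=> _; have -> : extension_sum p.1.1 p.1.2 p.2 =
      fun f => \sum_(s | matches s p.1.1 p.1.2 p.2) 1 * f s.
    by apply/funext => f; apply: eq_bigr => s _; rewrite mul1r.
  by apply: (reach_lincomb (fun=> 1) (u := fun s f => f s)) => s _; exists s.
apply: reach_subr (reach_bigU rN) => g [E [D [h ->]]].
by left; exists (E, D, h).
Qed.

(** A pair of sets of size k costs at most (n + 1) ^ 5 times the order of S_k, and these orders add
    up to the number of triples. *)
Lemma reach_rook_transform :
  reach (2 ^ n * #|{: rook n}| + n.+1 ^ 5 * #|{: rook n}|)
    (fun g => exists s, g = fun f : rook n -> F => f s)
    (fun g => exists k E D, [/\ #|E| = k, #|D| = k &
      entries (fun a b : irr_basis (W k) => fun f : rook n -> F =>
        \sum_(h in sym_below_group n k) irr_coef h a b * extension_sum E D h f) g]).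
Proof.
apply: reach_trans reach_extension_sums _.
set S := (X in reach _ X _).
pose T (p : {set 'I_n} * {set 'I_n}) := entries
  (fun a b : irr_basis (W #|p.2|) => fun f : rook n -> F =>
    \sum_(h in sym_below_group n #|p.2|) irr_coef h a b * extension_sum p.1 p.2 h f).
have rT (p : {set 'I_n} * {set 'I_n}) : #|p.1| == #|p.2| ->
    reach (n.+1 ^ 5 * #|sym_below n #|p.2| |) S (T p).
  move=> _; have Dn : (#|p.2| <= n)%N by rewrite (leq_trans (max_card _)) ?card_ord.
  apply: (@reach_le _ _ (chain_cost (sym_below_group n) #|p.2|)).
    by rewrite leq_mul2r leq_exp2r // ltnS Dn orbT.
  apply: reach_transform => //.
  - exact: sym_below0.
  - exact: sym_belowS.
  - exact: index_sym_below.
  - exact: adjacent_mem.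
  - exact: adjacent_cent.
  - exact: adjacent_word.
  by move=> h _; right; exists p.1, p.2, h.
apply: reach_subr (reach_le _ (reach_bigU rT)); last first.
  rewrite -big_distrr leq_mul2l; apply/orP; right.
  apply: leq_trans (card_triples n).
  rewrite -[X in (_ <= X)%N]sum1_card.
  rewrite [X in (_ <= X)%N](eq_bigl (fun p : {set 'I_n} * {set 'I_n} * 'S_n =>
    (#|p.1.1| == #|p.1.2|) && (p.2 \in sym_below n #|p.1.2|))); last first.
    by move=> p; rewrite inE.
  rewrite -(pair_big_dep (fun p : {set 'I_n} * {set 'I_n} => #|p.1| == #|p.2|)
    (fun p h => h \in sym_below n #|p.2|) (fun _ _ => 1%N)) /=.
  by apply: leq_sum => p _; rewrite sum1_card.
move=> g [k [E [D [cE cD]]]]; case: k / cD cE => cE eg; left.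
by exists (E, D) => //=; apply/eqP.
Qed.

End RookTransform.

Lemma cost_s_le (R : realType) n :
  (cost_s R n <= ((2 ^ n + n.+1 ^ 5) * #|{: rook n}|)%:R%:E)%E.
Proof.
pose F : numClosedFieldType := R[i].
have [W adW] := adapted_chain F (@sym_belowS n).
have [rho rhoE] := fin_all_exists (fun i =>
  @matrix_rep_extend R n _ (rook_rep W i) (rook_rep1 W i) (rook_repM W i)).
have complete : complete_irreps (members rho).
  apply: members_complete => [i|T|a a0]; first exact: rook_degree_gt0.
    have [a aT] := rook_rep_onto T; exists (finfun a) => i.
    by rewrite rhoE -aT; apply: eq_bigr => s _; rewrite ffunE.
  apply/ffunP => s; rewrite [RHS]ffunE; move: s.
  apply: (rook_rep_separating (W := W)) => i u v.
  have := a0 i; rewrite rhoE => /matrixP/(_ u v); rewrite summxE mxE => a0uv.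
  by rewrite -[RHS]a0uv; apply: eq_bigr => s _; rewrite [RHS]mxE.
have [|q qN qP] := reach_rook_transform adW (p := [::]).
  by move=> _ [s ->]; exists (Input _ s).
have qE : ((size q)%:R%:E <= ((2 ^ n + n.+1 ^ 5) * #|{: rook n}|)%:R%:E :> \bar R)%E.
  by rewrite lee_fin ler_nat mulnDl.
apply: le_trans qE.
apply: ge_ereal_inf; exists (transform_cost (@rook_basis R n) (members rho)).
  by exists (members rho).
apply: ge_ereal_inf; exists (size q)%:R%:E => //; exists q => // d _ [k] u v.
pose x := enum_val u; pose y := enum_val v.
have fourierE f : fourier (@rook_basis R n) (rho k) f u v =
    \sum_(h in sym_below n (tag k)) irr_coef h (rook_vector x) (rook_vector y) *
      extension_sum (val x.1) (val y.1) h f.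
  rewrite -[RHS](sum_rook_coef f x y) /fourier summxE; apply: eq_bigr => s _.
  by rewrite mxE rhoE rook_basis_delta mxE.
have [src srcP] : computes q (fun f =>
    \sum_(h in sym_below n (tag k)) irr_coef h (rook_vector x) (rook_vector y) *
      extension_sum (val x.1) (val y.1) h f : R[i]).
  apply: qP; exists (tag k), (val x.1), (val y.1); split.
  - by have := valP x.1; rewrite inE => /eqP.
  - by have := valP y.1; rewrite inE => /eqP.
  by exists (rook_vector x), (rook_vector y).
by exists src => f; rewrite fourierE srcP.
Qed.

(** * Asymptotics *)

Lemma fact_leq_rook n : (n`! <= #|{: rook n}|)%N.
Proof.
apply: leq_trans (card_triples n); rewrite -card_Sn -cardsT.
apply: (leq_card_in_set (f := fun h => (finset.setT, finset.setT, h))).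
  by move=> h h' _ _ [].
move=> h _; rewrite inE eqxx /=; apply/sym_belowP => i.
by rewrite cardsT card_ord leqNgt ltn_ord.
Qed.

(** The factors of n! beyond M exceed M, and [M ^ M] pays for the first M. *)
Lemma expn_leq_fact M n : (0 < M)%N -> (M ^ n <= n`! * M ^ M)%N.
Proof.
move=> M0; elim: n => [|n IHn]; first by rewrite mul1n expn_gt0 M0.
have [nM|Mn] := leqP n.+1 M.
  by rewrite (leq_trans (leq_pexp2l M0 nM)) // leq_pmull ?fact_gt0.
by rewrite expnS factS -mulnA leq_mul // ltnW.
Qed.

Lemma overhead_leq n : (2 ^ n + n.+1 ^ 5 <= 2 * 32 ^ n)%N.
Proof.
have le1 : (2 ^ n <= 32 ^ n)%N by case: n => // n; rewrite leq_exp2r.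
have le2 : (n.+1 ^ 5 <= 32 ^ n)%N.
  by rewrite -[32%N]/(2 ^ 5)%N -expnM mulnC expnM leq_exp2r // ltn_expl.
lia.
Qed.

Section Asymptotics.
Variables (R : realType) (eps : R).
Hypothesis eps_gt0 : 0 < eps.

Lemma expn_bigO_rook : exists K : R, forall n,
  (2 ^ n + n.+1 ^ 5)%:R <= K * #|{: rook n}|%:R `^ eps.
Proof.
(* Chosen so that its power eps is 32, the base in [overhead_leq]; rounding up to the integer [M]
   permits the comparison with n!. *)
pose b : R := 32 `^ eps^-1.
pose M := (Num.truncn b).+1.
have bM : b <= M%:R by exact/ltW/truncnS_gt.
have M32 : 32 <= M%:R `^ eps.
  have -> : 32 = b `^ eps :> R by rewrite -powRrM mulVf ?powRr1 // gt_eqF.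
  by apply: ge0_ler_powR; rewrite ?nnegrE ?powR_ge0 ?ler0n // ltW.
exists (2 * (M ^ M)%:R `^ eps) => n.
apply: (@le_trans _ _ (2 * 32 ^+ n)).
  by rewrite -natrX -natrM ler_nat overhead_leq.
rewrite -mulrA ler_pM2l //.
apply: (@le_trans _ _ ((M ^ n)%:R `^ eps)).
  rewrite natrX -powR_mulrn // -powRrM mulrC powRrM powR_mulrn ?powR_ge0 //.
  by apply: lerXn2r; rewrite ?nnegrE ?powR_ge0.
rewrite -powRM // -natrM.
apply: ge0_ler_powR; rewrite ?nnegrE ?ler0n ?ler_nat //; first exact: ltW.
by rewrite (leq_trans (expn_leq_fact n _)) // mulnC leq_mul2l fact_leq_rook orbT.
Qed.

Lemma transform_cost_ge0 n (e : rook n -> rook_algebra R n) (Y : rep_set R n) :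
  (0 <= transform_cost e Y)%E.
Proof. by apply/ereal_infP => _ [p _ <-]; rewrite lee_fin. Qed.

Lemma min_cost_ge0 n (e : rook n -> rook_algebra R n) : (0 <= min_cost e)%E.
Proof. by apply/ereal_infP => _ [Y _ <-]; apply: transform_cost_ge0. Qed.

(** Stated for any nonnegative sequence below [cost_s], so that it serves both claims; the bound
    holds for every n. *)
Lemma bigO_le_cost_s (u : nat -> \bar R) :
  (forall n, 0 <= u n)%E -> (forall n, u n <= cost_s R n)%E ->
  ereal_bigO u (fun n => #|{: rook n}|%:R `^ (1 + eps)).
Proof.
move=> u0 uc; have [K KP] := expn_bigO_rook; exists K; apply: nearW => n.
rewrite gee0_abs // (le_trans (uc n)) // (le_trans (cost_s_le R n)) // lee_fin.
rewrite ger0_norm ?powR_ge0 // natrM.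
have c0 : #|{: rook n}|%:R != 0 :> R.
  by rewrite pnatr_eq0 -lt0n (leq_trans (fact_gt0 n)) ?fact_leq_rook.
rewrite powRD; last by rewrite c0 implybT.
by rewrite powRr1 // [leRHS]mulrCA [leLHS]mulrC ler_wpM2l.
Qed.

End Asymptotics.

Theorem theorem8p2 (R : realType) (eps : R) (heps : 0 < eps) :
  ereal_bigO (fun n => cost_s R n) (fun n => #|{: rook n}|%:R `^ (1 + eps)) /\
  ereal_bigO (fun n => cost R n) (fun n => #|{: rook n}|%:R `^ (1 + eps)).
Proof.
split; apply: bigO_le_cost_s => // n; first exact: min_cost_ge0.
  by rewrite le_min; apply/andP; split; apply: min_cost_ge0.
by rewrite ge_min; apply/orP; left; apply: lexx.
Qed.
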